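(* Let $\mathcal{M}$ be a smooth manifold. The mapping $X\mapsto VX^{c*}$, sending a vector field $X\in\mathfrak{X}(\mathcal{M})$ to the vertical representative of its complete cotangent lift, is a Lie algebra isomorphism onto its image (an injective Lie algebra homomorphism) from $\mathfrak{X}(\mathcal{M})$ with the Jacobi--Lie bracket into the first order generalized vector fields of the bundle $\pi_{\mathcal{M}}:T^*\mathcal{M}\to\mathcal{M}$ with the bracket $[\ ,\ ]_{pro}$. In particular, for all $X,Y\in\mathfrak{X}(\mathcal{M})$, $$V[X,Y]^{c*}=[VX^{c*},VY^{c*}]_{pro}.$$
   Context: Let $(x^a)$ be local coordinates on $\mathcal{M}$, $(x^a,y_a)$ the induced coordinates on $T^*\mathcal{M}$, and let $y_{a,b}$ denote the first order jet coordinates on $J^1\pi_{\mathcal{M}}$ (the value of $y_{a,b}$ on $j^1_x\phi$ is $\partial\phi_a/\partial x^b$ for a local one-form $\phi=\phi_a dx^a$); $y_{a,bc}$ are second order jet coordinates. The complete cotangent lift $X^{c*}$ of $X=X^a(x)\,\partial/\partial x^a$ is the infinitesimal generator of the flow $T^*\varphi_{-t}$ on $T^*\mathcal{M}$, where $\varphi_t$ is the flow of $X$. In coordinates $$X^{c*}=X^a\frac{\partial}{\partial x^a}-y_b\frac{\partial X^b}{\partial x^a}\frac{\partial}{\partial y_a}.$$ A (projectable) generalized vector field of order one on $\pi_{\mathcal{M}}$ has the form $\xi=\xi^a(x)\,\partial/\partial x^a+\xi_a(x,y,y_1)\,\partial/\partial y_a$, where $y_1$ stands for the first order jet coordinates.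 Its first prolongation is $pr^1\xi=\xi+\Phi_{a,b}\,\partial/\partial y_{a,b}$ with $\Phi_{a,b}=D_{x^b}(\xi_a-\xi^cy_{a,c})+\xi^cy_{a,cb}$, where $D_{x^b}$ is the total derivative. The bracket is $$[\xi,\eta]_{pro}=\big(pr^1\xi(\eta^a)-pr^1\eta(\xi^a)\big)\frac{\partial}{\partial x^a}+\big(pr^1\xi(\eta_a)-pr^1\eta(\xi_a)\big)\frac{\partial}{\partial y_a}.$$ The vertical representative of a projectable vector field $\xi=\xi^a\,\partial/\partial x^a+\xi_a\,\partial/\partial y_a$ on $T^*\mathcal{M}$ is the generalized vector field $V\xi=(\xi_a-\xi^by_{a,b})\,\partial/\partial y_a$. Hence $$VX^{c*}=-\Big(y_b\frac{\partial X^b}{\partial x^a}+X^by_{a,b}\Big)\frac{\partial}{\partial y_a}.$$ *)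

(* Defs.v *)
From HB Require Import structures.
From mathcomp Require Import all_boot all_order all_algebra.
From mathcomp Require Import all_classical all_reals all_analysis.

Set Implicit Arguments.
Unset Strict Implicit.
Unset Printing Implicit Defensive.

Import Order.TTheory GRing.Theory Num.Theory.
Import numFieldNormedType.Exports.

Local Open Scope classical_set_scope.
Local Open Scope ring_scope.

(* C^oo on an open subset U of a finite-dimensional space V: all iterated
   directional derivatives, in arbitrary directions, are differentiable
   on U. *)
Definition iter_derive (R : realType) (V W : normedModType R)
    (vs : seq V) (f : V -> W) : V -> W :=
  foldr (fun v (g : V -> W) => fun x => 'D_v g x) f vs.

Definition smooth_on (R : realType) (V W : normedModType R)
    (U : set V) (f : V -> W) : Prop :=
  forall (vs : seq V) (x : V), U x -> differentiable (iter_derive vs f) x.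

(* A Hausdorff, second countable space with a smooth n-dimensional atlas.
   The maps [chart i] and [param i] are total functions whose values are only
   meaningful on [chart_dom i] and on its image [chart_img i] respectively.
   The atlas need not be maximal. *)
Record smooth_manifold (R : realType) (n : nat) := SmoothManifold {
  point_of :> topologicalType;
  mfd_hausdorff : hausdorff_space point_of;
  mfd_second_countable : @second_countable point_of;
  chart_index : Type;
  chart_dom : chart_index -> set point_of;
  chart : chart_index -> point_of -> 'rV[R]_n;
  param : chart_index -> 'rV[R]_n -> point_of;
  chart_cover : forall p, exists i, chart_dom i p;
  chart_dom_open : forall i, open (chart_dom i);
  chart_img_open : forall i, open (chart i @` chart_dom i);
  chartK : forall i p, chart_dom i p -> param i (chart i p) = p;
  chart_continuous : forall i p, chart_dom i p -> {for p, continuous (chart i)};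
  param_continuous : forall i x, (chart i @` chart_dom i) x ->
    {for x, continuous (param i)};
  transition_smooth : forall i j,
    smooth_on (chart i @` (chart_dom i `&` chart_dom j)) (chart j \o param i)
}.

(* Coordinates on T^*M are pairs (x, y); on J^1 they are triples (x, y, y1)
   with y1 a b = y_{a,b}; on J^2 one adds y2 with y2 a b c = y_{a,bc}. *)
Notation cot_space R n := ('rV[R]_n * 'rV[R]_n)%type (only parsing).
Notation jet1_space R n := ('rV[R]_n * 'rV[R]_n * 'M[R]_n)%type (only parsing).
Notation jet2_space R n :=
  ('rV[R]_n * 'rV[R]_n * 'M[R]_n * ('I_n -> 'M[R]_n))%type (only parsing).

Section LocalFormulas.
Variables (R : realType) (n : nat).

Definition symmetric_jet (w : jet2_space R n) : Prop :=
  forall a b c, w.2 a b c = w.2 a c b.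

(* Local representative xi^a(x) d/dx^a + xi_a d/dy_a of a projectable field
   whose fibre components xi_a are functions on T: T is [cot_space] for vector
   fields on T^*M, [jet1_space] and [jet2_space] for generalized vector fields
   of order one and two. *)
Record field_on (T : Type) := FieldOn {
  base : 'rV[R]_n -> 'rV[R]_n;
  fibre : T -> 'rV[R]_n
}.

Definition basis_row (a : 'I_n) : 'rV[R]_n := delta_mx 0 a.

Definition partial (V : normedModType R) (f : 'rV[R]_n -> V) (a : 'I_n)
  (x : 'rV[R]_n) : V := 'D_(basis_row a) f x.

Definition partial_x (f : jet1_space R n -> R) (a : 'I_n) (z : jet1_space R n) : R :=
  'D_((basis_row a, 0, 0) : jet1_space R n) f z.
Definition partial_y (f : jet1_space R n -> R) (a : 'I_n) (z : jet1_space R n) : R :=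
  'D_((0, basis_row a, 0) : jet1_space R n) f z.
Definition partial_y1 (f : jet1_space R n -> R) (a b : 'I_n) (z : jet1_space R n) : R :=
  'D_((0, 0, delta_mx a b) : jet1_space R n) f z.

Definition lie_bracket_loc (X Y : 'rV[R]_n -> 'rV[R]_n) : 'rV[R]_n -> 'rV[R]_n :=
  fun x => \row_a \sum_b
    (X x 0 b * partial Y b x 0 a - Y x 0 b * partial X b x 0 a).

Definition cotangent_lift_loc (X : 'rV[R]_n -> 'rV[R]_n) : field_on (cot_space R n) :=
  {| base := X;
     fibre := fun u : cot_space R n => \row_a - \sum_b u.2 0 b * partial X a u.1 0 b |}.

Definition vertical_rep_loc (xi : field_on (cot_space R n)) : field_on (jet1_space R n) :=
  {| base := fun=> 0;
     fibre := fun z : jet1_space R n =>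
       \row_a (fibre xi z.1 0 a - \sum_b base xi z.1.1 0 b * z.2 a b) |}.

Definition total_derivative (f : jet1_space R n -> R) (b : 'I_n) (w : jet2_space R n) : R :=
  let: (z, y2) := w in
  partial_x f b z + \sum_a z.2 a b * partial_y f a z
  + \sum_a \sum_c y2 a c b * partial_y1 f a c z.

Definition prolongation_coef (xi : field_on (jet1_space R n)) (a b : 'I_n)
    (w : jet2_space R n) : R :=
  total_derivative
    (fun z => fibre xi z 0 a - \sum_c base xi z.1.1 0 c * z.2 a c) b w
  + \sum_c base xi w.1.1.1 0 c * w.2 a c b.

Definition prolongation_apply (xi : field_on (jet1_space R n)) (f : jet1_space R n -> R)
    (w : jet2_space R n) : R :=
  \sum_b base xi w.1.1.1 0 b * partial_x f b w.1
  + \sum_a fibre xi w.1 0 a * partial_y f a w.1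
  + \sum_a \sum_b prolongation_coef xi a b w * partial_y1 f a b w.1.

(* The base components eta^a depend on x only, so pr^1 xi (eta^a) reduces to
   xi^b d eta^a / dx^b, that is, to the bracket of the base components.  The
   fibre components of a bracket of first order fields live on J^2. *)
Definition pro_bracket_loc (xi eta : field_on (jet1_space R n)) : field_on (jet2_space R n) :=
  {| base := lie_bracket_loc (base xi) (base eta);
     fibre := fun w : jet2_space R n => \row_a
       (prolongation_apply xi (fun z => fibre eta z 0 a) w
        - prolongation_apply eta (fun z => fibre xi z 0 a) w) |}.

(* For a local diffeomorphism f with inverse g: the map T^*g, which covers f,
   sends the covector y_b dx^b at x to the one with components
   y_b (dg^b/dx^a)(f x) at f x. *)
Definition cot_map (f g : 'rV[R]_n -> 'rV[R]_n) (u : cot_space R n) : (cot_space R n) :=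
  (f u.1, \row_a \sum_b u.2 0 b * partial g a (f u.1) 0 b).

(* The prolongation of [cot_map f g] to first jets, obtained by differentiating
   the transformed one-form x' |-> phi_c(g x') (dg^c/dx^a)(x') at x' = f x. *)
Definition jet1_map (f g : 'rV[R]_n -> 'rV[R]_n) (z : jet1_space R n) : (jet1_space R n) :=
  (cot_map f g z.1,
   \matrix_(a, b)
     (\sum_c \sum_d z.2 c d * partial g b (f z.1.1) 0 d * partial g a (f z.1.1) 0 c
      + \sum_c z.1.2 0 c * partial (partial g a) b (f z.1.1) 0 c)).

End LocalFormulas.

Section Manifold.
Variables (R : realType) (n : nat) (M : smooth_manifold R n).
Notation I := (chart_index M).

Definition chart_img (i : I) : set 'rV[R]_n := chart i @` chart_dom i.
Definition overlap (i j : I) : set 'rV[R]_n :=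
  chart i @` (chart_dom i `&` chart_dom j).
Definition transition (i j : I) : 'rV[R]_n -> 'rV[R]_n := chart j \o param i.

(* Geometric objects are families of local representatives, one per chart,
   which are smooth on the chart and agree on overlaps.  Their values off the
   chart are irrelevant, hence equality of objects is equality over charts. *)
Definition vf_family := I -> 'rV[R]_n -> 'rV[R]_n.
Definition field_family (T : Type) := I -> field_on R n T.

Definition is_vector_field (X : vf_family) : Prop :=
  (forall i, smooth_on (chart_img i) (X i)) /\
  (forall i j x, overlap i j x ->
     X j (transition i j x) = 'D_(X i x) (transition i j) x).

Definition vf_eq (X Y : vf_family) : Prop :=
  forall i x, chart_img i x -> X i x = Y i x.

Definition is_cot_vector_field (xi : field_family (cot_space R n)) : Prop :=
  (forall i, smooth_on (chart_img i) (base (xi i)) /\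
     smooth_on [set u : cot_space R n | chart_img i u.1] (fibre (xi i))) /\
  (forall i j (u : cot_space R n), overlap i j u.1 ->
     let f := transition i j in let g := transition j i in
     (base (xi j) (f u.1), fibre (xi j) (cot_map f g u)) =
       'D_((base (xi i) u.1, fibre (xi i) u) : cot_space R n) (cot_map f g) u).

Definition is_generalized_vector_field (xi : field_family (jet1_space R n)) : Prop :=
  (forall i, smooth_on (chart_img i) (base (xi i)) /\
     smooth_on [set z : jet1_space R n | chart_img i z.1.1] (fibre (xi i))) /\
  (forall i j (z : jet1_space R n), overlap i j z.1.1 ->
     let f := transition i j in let g := transition j i in
     (base (xi j) (f z.1.1), fibre (xi j) (jet1_map f g z)) =
       'D_((base (xi i) z.1.1, fibre (xi i) z) : cot_space R n) (cot_map f g) z.1).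

Definition gvf_eq (xi eta : field_family (jet1_space R n)) : Prop :=
  forall i (z : jet1_space R n), chart_img i z.1.1 ->
    base (xi i) z.1.1 = base (eta i) z.1.1 /\ fibre (xi i) z = fibre (eta i) z.

(* Second order fields are functions of symmetric second jets. *)
Definition gvf2_eq (xi eta : field_family (jet2_space R n)) : Prop :=
  forall i (w : jet2_space R n), chart_img i w.1.1.1 -> symmetric_jet w ->
    base (xi i) w.1.1.1 = base (eta i) w.1.1.1 /\ fibre (xi i) w = fibre (eta i) w.

(* A first order field viewed as a second order one. *)
Definition to_order2 (xi : field_family (jet1_space R n)) :
    field_family (jet2_space R n) :=
  fun i => {| base := base (xi i); fibre := fun w => fibre (xi i) w.1 |}.

Definition vf_lincomb (k : R) (X Y : vf_family) : vf_family :=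
  fun i x => k *: X i x + Y i x.

Definition gvf_lincomb (k : R) (xi eta : field_family (jet1_space R n)) :
    field_family (jet1_space R n) :=
  fun i => {| base := fun x => k *: base (xi i) x + base (eta i) x;
              fibre := fun z => k *: fibre (xi i) z + fibre (eta i) z |}.

Definition lie_bracket (X Y : vf_family) : vf_family :=
  fun i => lie_bracket_loc (X i) (Y i).

Definition cotangent_lift (X : vf_family) : field_family (cot_space R n) :=
  fun i => cotangent_lift_loc (X i).

Definition vertical_rep (xi : field_family (cot_space R n)) :
    field_family (jet1_space R n) :=
  fun i => vertical_rep_loc (xi i).

Definition pro_bracket (xi eta : field_family (jet1_space R n)) :
    field_family (jet2_space R n) :=
  fun i => pro_bracket_loc (xi i) (eta i).

(* A smooth local flow of X, defined on an open neighbourhood D of {0} x M in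
   R x M whose time sections are intervals; the maximal flow is one. *)
Record is_local_flow (X : vf_family) (D : set (R * M)) (phi : R -> M -> M) : Prop := {
  flow_open : open D;
  flow_dom0 : forall p, D (0, p);
  flow_dom_interval : forall (t s : R) p, 0 <= s <= 1 -> D (t, p) -> D (s * t, p);
  flow_0 : forall p, phi 0 p = p;
  flow_add : forall s t p, D (s, p) -> D (t, phi s p) -> D (t + s, p) ->
    phi t (phi s p) = phi (t + s) p;
  flow_continuous : forall u, D u -> {for u, continuous (fun v : R * M => phi v.1 v.2)};
  flow_smooth : forall i j,
    smooth_on
      [set u : R * 'rV[R]_n | [/\ chart_img i u.2, D (u.1, param i u.2) &
         chart_dom j (phi u.1 (param i u.2))]]
      (fun u : R * 'rV[R]_n => chart j (phi u.1 (param i u.2)));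
  flow_velocity : forall j t p, D (t, p) -> chart_dom j (phi t p) ->
    is_derive t 1 (fun s => chart j (phi s p)) (X j (chart j (phi t p)))
}.

(* xi is the infinitesimal generator of t |-> T^*phi_{-t}, where phi is any
   local flow of X: for small t this curve stays in the chart, where T^*phi_{-t}
   is [cot_map phi_t phi_{-t}]. *)
Definition generates_cotangent_flow (X : vf_family)
    (xi : field_family (cot_space R n)) : Prop :=
  forall D phi, is_local_flow X D phi ->
  forall i (u : cot_space R n), chart_img i u.1 ->
    let phi_loc := fun t x => chart i (phi t (param i x)) in
    is_derive (0 : R) 1 (fun t : R => cot_map (phi_loc t) (phi_loc (- t)) u)
      ((base (xi i) u.1, fibre (xi i) u) : cot_space R n).

End Manifold.

(* Main.v *)
Require Import Defs.
From mathcomp Require Import all_boot all_order all_algebra.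
From mathcomp Require Import all_classical all_reals all_analysis.
From mathcomp Require Import ring.

(* With y.v = y_b v^b, the components of V X^{c*} are
   - y.(d_a X) - X^b y_{a,b}; in particular they determine X.  Invariance under a
   change of charts g from x' to x is a single identity: differentiating the
   relation D_{X'} g = X o g in a direction v gives
     D_{D_v X'} g + D_{X'} (D_v g) = D_{D_v g} X o g,
   and pairing it with y gives the transformation laws of X^{c*} and V X^{c*};
   its antisymmetrization is that of the Lie bracket.  The bracket formula is a
   computation in one chart, where D_v (D_X Y) = D_{D_v X} Y + D_X (D_v Y).
   For the flow, d/dt of the Jacobian of phi_{-t} at phi_t(x) is
   - d_a (d/dt phi_t) = - d_a X at t = 0, since phi_0 has constant Jacobian.
   All these steps rest on the symmetry of second derivatives. *)

Set Implicit Arguments.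
Unset Strict Implicit.
Unset Printing Implicit Defensive.

Import Order.TTheory GRing.Theory Num.Theory.
Import numFieldNormedType.Exports.

Local Open Scope classical_set_scope.
Local Open Scope ring_scope.

(** Local representatives are total functions that are meaningful only on an open set. An identity
    that is to be differentiated therefore holds only near the point, and it must be transferred
    through germs each time. The directions of differentiation are themselves fields, such as [X] or
    [partial g a], so one needs a product rule for ['D_(Z y) f y] in which the direction moves with
    the point: this is [derive_along], and the symmetry of second derivatives enters there.
    Smoothness is given as differentiability of all iterated directional derivatives; an induction
    on the directions does not close on a product or a composite, whose derivative has another
    shape, and this is why closure properties go through a class of functions stable under
    derivatives. Covectors are carried by the transposed derivative of [g], the inverse of the
    change of charts [f], so the fibre computations run through [g], which carries [X'] to [X], and
    no Jacobian has to be inverted. *)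

(** * Directional derivatives: germs, linearity, chain rule, matrix entries *)

Section DifferentialCalculus.
Variables (R : realType) (V W : normedModType R).

(** The first order expansion at [x] sees only the germ of the function, so ['d f x] also serves as
    differential of [g]. *)
Lemma near_eq_differentiable (f g : V -> W) (x : V) :
  (\near x, f x = g x) -> differentiable f x -> differentiable g x.
Proof.
move=> fg df; have [cf ef] := (diff_locallyP _ _).1 df.
have eg : g \o shift x = cst (g x) + 'd f x +o_ 0 id.
  apply/eqaddoP => e e0; move/eqaddoP: ef => /(_ e e0); apply: filter_app.
  have : \forall h \near (0 : V), f (h + x) = g (h + x).
    move: fg; rewrite (near_shift 0)/=; apply: filterS => h.
    by rewrite subr0.
  apply: filterS => h /= fgh.
  by rewrite -![(_ + _ : _ -> _) _]/(_ + _) /= -(nbhs_singleton fg) -fgh.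
by apply/diff_locallyP; rewrite (diff_unique cf eg).
Qed.

Lemma deriveDdir (f : V -> W) x u v : differentiable f x ->
  'D_(u + v) f x = 'D_u f x + 'D_v f x.
Proof. by move=> df; rewrite !deriveE// linearD. Qed.

Lemma deriveZdir (f : V -> W) x k v : differentiable f x ->
  'D_(k *: v) f x = k *: 'D_v f x.
Proof. by move=> df; rewrite !deriveE// linearZ. Qed.

Lemma deriveNdir (f : V -> W) x v : differentiable f x ->
  'D_(- v) f x = - 'D_v f x.
Proof. by move=> df; rewrite !deriveE// linearN. Qed.

Lemma deriveBdir (f : V -> W) x u v : differentiable f x ->
  'D_(u - v) f x = 'D_u f x - 'D_v f x.
Proof. by move=> df; rewrite !deriveE// linearB. Qed.

Lemma derive_sumdir (f : V -> W) x (I : finType) (v : I -> V) :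
  differentiable f x -> 'D_(\sum_i v i) f x = \sum_i 'D_(v i) f x.
Proof.
move=> df; rewrite deriveE// linear_sum; apply: eq_bigr => i _.
by rewrite deriveE.
Qed.

Lemma derive_linear (L : {linear V -> W}) x v :
  continuous L -> 'D_v L x = L v.
Proof. by move=> cL; rewrite deriveE ?diff_lin//; exact: linear_differentiable. Qed.

Lemma derive_fun_sum (I : finType) (h : I -> V -> W) x v :
  (forall i, differentiable (h i) x) ->
  'D_v (fun y => \sum_i h i y) x = \sum_i 'D_v (h i) x.
Proof.
move=> dh; have -> : (fun y => \sum_i h i y) = \sum_i h i.
  by apply/funext => y; rewrite fct_sumE.
(* Differentiability of the partial sums is carried along, because [deriveD] asks for it at each
   induction step. *)
suff [_ ->] : differentiable (\sum_i h i) x /\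
  'D_v (\sum_i h i) x = \sum_i 'D_v (h i) x by [].
elim/big_rec2: _ => [|i y1 y2 _ [dy <-]].
  by split; [exact: differentiable_cst|exact: derive_cst].
split; first exact: differentiableD.
by rewrite deriveD//; exact: diff_derivable.
Qed.

Lemma differentiable_fun_sum (I : finType) (h : I -> V -> W) x :
  (forall i, differentiable (h i) x) ->
  differentiable (fun y => \sum_i h i y) x.
Proof.
move=> dh; have -> : (fun y => \sum_i h i y) = \sum_i h i.
  by apply/funext => y; rewrite fct_sumE.
by elim/big_rec: _ => [|i y _ dy]; [exact: differentiable_cst|exact: differentiableD].
Qed.

End DifferentialCalculus.

Section ChainRule.
Variables (R : realType) (U V W : normedModType R).

Lemma derive_compose (f : U -> V) (g : V -> W) x u :
  differentiable f x -> differentiable g (f x) ->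
  'D_u (g \o f) x = 'D_('D_u f x) g (f x).
Proof.
move=> df dg; rewrite !deriveE//; last exact: differentiable_comp.
by rewrite diff_comp.
Qed.

Lemma derive_pair (f : U -> V) (g : U -> W) x u :
  differentiable f x -> differentiable g x ->
  'D_u (fun y => (f y, g y)) x = ('D_u f x, 'D_u g x).
Proof.
move=> df dg; rewrite !deriveE//; last exact: differentiable_pair.
by rewrite diff_pair.
Qed.

End ChainRule.

Section MatrixValued.
Variables (R : realType) (V : normedModType R) (m n : nat).

Lemma differentiable_mxP (M : V -> 'M[R]_(m, n)) x :
  differentiable M x <-> forall i j, differentiable (fun y => M y i j) x.
Proof.
split=> dM => [i j|].
  exact: (differentiable_comp dM (differentiable_coord _ _ _)).
have -> : M = fun y => \sum_i \sum_j M y i j *: delta_mx i j.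
  by apply/funext => y; exact: matrix_sum_delta.
by do 2![apply: differentiable_fun_sum => ?]; exact: differentiableZl.
Qed.

Lemma derive_coord (M : V -> 'M[R]_(m, n)) x v i j :
  differentiable M x -> 'D_v M x i j = 'D_v (fun y => M y i j) x.
Proof. by move=> dM; rewrite derive_mx ?mxE//; exact: diff_derivable. Qed.

End MatrixValued.

(** * Symmetry of second derivatives *)

Section MixedDerivatives.
Variables (R : realType) (V : normedModType R).

Lemma is_derive_line (W : normedModType R) (f : V -> W) p v (s : R) :
  differentiable f (s *: v + p) ->
  is_derive s 1 (fun t : R => f (t *: v + p)) ('D_v f (s *: v + p)).
Proof.
move=> df; have [dl el] : is_diff s (fun t : R => t *: v + p) ( *:%R^~ v).
  have dg : is_diff s (( *:%R^~ v : R -> V) + cst p) (( *:%R^~ v) + 0).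
    exact: is_diffD.
  by apply: is_diff_eq; rewrite addr0.
have dfl : differentiable (f \o (fun t : R => t *: v + p)) s.
  exact: differentiable_comp.
apply: DeriveDef; first exact: diff_derivable.
rewrite -[LHS]/('D_1 (f \o (fun t : R => t *: v + p)) s).
by rewrite derive_compose// [X in 'D_X f _]deriveE// el scale1r.
Qed.

(** The second difference is [g h - g 0], where [g s] is the increment of [f] along [h *: w] at
    [s *: v + x]. The mean value theorem turns it into [h] times a difference of two values of
    ['D_v f], and the first order expansion of ['D_v f] at [x] evaluates both of them. *)
Lemma second_difference_le (f : V -> R) (x v w : V) (e : R) : 0 < e ->
  (\forall y \near x, differentiable f y) -> differentiable ('D_v f) x ->
  \forall h \near (0 : R)^'+,
    `|f (h *: v + (h *: w + x)) - f (h *: v + x) - f (h *: w + x) + f x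
       - h ^+ 2 * 'D_w ('D_v f) x| <= e * h ^+ 2.
Proof.
(* All displacements [s *: v + t *: w] with [s], [t] in [[0, h]] have norm at most [h * N]; the
   summand 1 keeps [N] positive when [v] and [w] vanish. With [e'] as below, two remainders of size
   [e' * (h * N)], multiplied by [h], add up to [e * h ^+ 2]. *)
move=> e0 df dF; set N := `|v| + `|w| + 1.
have N0 : 0 < N by rewrite ltr_wpDl// addr_ge0.
pose e' := e / (2 * N); have e'0 : 0 < e' by rewrite divr_gt0// mulr_gt0.
have [d /= d0 dfd] : exists2 d : R, 0 < d &
    forall y, `|y| < d -> differentiable f (y + x).
  move: df => /nbhs_ballP[d /= d0 df]; exists d => // y yd; apply: df.
  by rewrite -ball_normE /= opprD addrCA subrr addr0 normrN.
have [d1 /= d10 dF1] : exists2 d : R, 0 < d & forall k, `|k| < d ->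
    `|'D_v f (k + x) - ('D_v f x + 'd ('D_v f) x k)| <= e' * `|k|.
  have /eqaddoP/(_ _ e'0)/nbhs_ballP[d1 /= d10 h1] := diff_locally dF.
  exists d1 => // k kd; apply: h1.
  by rewrite -ball_normE /= sub0r normrN.
near=> h.
have h0 : 0 < h by near: h; exact: nbhs_right_gt.
have small (s t : R) : 0 <= s <= h -> 0 <= t <= h ->
    `|s *: v + t *: w| <= h * N.
  move=> /andP[s0 sh] /andP[t0 th]; apply: (le_trans (ler_normD _ _)).
  rewrite !normrZ !ger0_norm// /N !mulrDr mulr1 -addrA lerD//.
    by rewrite ler_wpM2r.
  by rewrite -[leLHS]addr0 lerD ?ler_wpM2r// ltW.
have hN : h * N < Num.min d d1.
  rewrite -ltr_pdivlMr//; near: h; apply: nbhs_right_lt.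
  by rewrite divr_gt0// lt_min d0.
move: hN; rewrite lt_min => /andP[hNd hNd1].
have hh : 0 <= h <= h by rewrite ltW//=.
have h00 : 0 <= (0 : R) <= h by rewrite lexx ltW.
pose g (s : R) := f (s *: v + (h *: w + x)) - f (s *: v + x).
pose dg (s : R) : R := 'D_v f (s *: v + (h *: w + x)) - 'D_v f (s *: v + x).
have dgE (s : R) : 0 <= s <= h -> is_derive s 1 g (dg s).
  move=> s0h; apply: is_deriveB; apply: is_derive_line.
    by rewrite addrA; apply: dfd; apply: le_lt_trans hNd; exact: small.
  apply: dfd; apply: le_lt_trans hNd.
  by have := small _ _ s0h h00; rewrite scale0r addr0.
have [c c0h] : exists2 c : R, c \in `]0, h[%R & g h - g 0 = dg c * (h - 0).
  apply: MVT => //.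
    by move=> s; rewrite in_itv /= => /andP[s0 sh]; apply: dgE; rewrite !ltW.
  apply: derivable_within_continuous => s; rewrite in_itv /= => sh.
  by have [] := dgE _ sh.
rewrite (_ : _ - _ - _ + _ = g h - g 0); last first.
  by rewrite /g scale0r !add0r; ring.
rewrite subr0 => ->.
have {}c0h : 0 <= c <= h by move: c0h; rewrite in_itv /= => /andP[? ?]; rewrite !ltW.
have -> : 'D_w ('D_v f) x = 'd ('D_v f) x w by rewrite deriveE.
have r1 := dF1 _ (le_lt_trans (small _ _ c0h hh) hNd1).
have cN : `|c *: v| <= h * N.
  by have := small _ _ c0h h00; rewrite scale0r addr0.
have r2 := dF1 _ (le_lt_trans cN hNd1).
have dZ k u : 'd ('D_v f) x (k *: u) = k *: 'd ('D_v f) x u by exact: linearZ.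
move: r1 r2; rewrite -addrA (linearD ('d ('D_v f) x)) /= !dZ.
set A : R := 'D_v f (c *: v + _); set B : R := 'D_v f (c *: v + x).
set P : R := 'd _ x v; set Q : R := 'd _ x w; set F : R := 'D_v f x => r1 r2.
(* The unknown [c] disappears: the linear parts of the two expansions share [F + c *: P] and differ
   by [h *: Q], so only the two remainders are left. *)
have -> : dg c * h - h ^+ 2 * Q =
    h * ((A - (F + (c *: P + h *: Q))) - (B - (F + c *: P))).
  by rewrite /dg -/A -/B /GRing.scale /=; ring.
rewrite normrM gtr0_norm//.
have -> : e * h ^+ 2 = h * (e' * (h * N) + e' * (h * N)).
  by rewrite /e'; field; rewrite gt_eqF.
rewrite ler_pM2l//; apply: (le_trans (ler_normB _ _)); apply: lerD.
  by apply: (le_trans r1); rewrite ler_pM2l//; exact: small.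
by apply: (le_trans r2); rewrite ler_pM2l.
Unshelve. all: by end_near. Qed.

(* The second difference is symmetric in v and w, while [second_difference_le]
   makes it approximate both mixed derivatives. *)
Lemma derive_comm_real (f : V -> R) (x v w : V) :
  (\forall y \near x, differentiable f y) ->
  differentiable ('D_v f) x -> differentiable ('D_w f) x ->
  'D_w ('D_v f) x = 'D_v ('D_w f) x.
Proof.
move=> df dv dw; apply/eqP; rewrite -subr_eq0 -normr_le0; apply/ler_addgt0Pl => e e0.
have e2 : 0 < e / 2 by rewrite divr_gt0.
rewrite addr0.
have [h [/= [h0 hv] hw]] := filter_ex (filterI (filterI (nbhs_right_gt 0)
  (second_difference_le w e2 df dv)) (second_difference_le v e2 df dw)).
set A := 'D_w _ x in hv *; set B := 'D_v ('D_w f) x in hw *.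
rewrite -(@ler_pM2l _ (h ^+ 2)) ?exprn_gt0//.
rewrite -[X in X * `|_|]gtr0_norm ?exprn_gt0// -normrM.
rewrite addrCA in hw; set a := f _ in hv hw.
have -> : h ^+ 2 * e = e / 2 * h ^+ 2 + e / 2 * h ^+ 2 by field.
apply: le_trans (lerD hv hw); rewrite -[X in _ <= X + _]normrN.
by apply: le_trans (ler_normD _ _); rewrite le_eqVlt; apply/orP; left;
  apply/eqP; congr `|_|; ring.
Qed.

Lemma derive_comm n (f : V -> 'rV[R]_n) (x v w : V) :
  (\forall y \near x, differentiable f y) ->
  differentiable ('D_v f) x -> differentiable ('D_w f) x ->
  'D_w ('D_v f) x = 'D_v ('D_w f) x.
Proof.
move=> df dv dw; apply/rowP => a.
transitivity ('D_w (fun y => 'D_v f y 0 a) x); first exact: derive_coord.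
transitivity ('D_v (fun y => 'D_w f y 0 a) x); last exact/esym/derive_coord.
have dE u : \forall y \near x, 'D_u f y 0 a = 'D_u (fun z => f z 0 a) y.
  by apply: filterS df => y dy; exact: derive_coord.
have da u : differentiable ('D_u f) x -> differentiable ('D_u (fun z => f z 0 a)) x.
  move=> du; apply: near_eq_differentiable (dE u) _.
  by move/differentiable_mxP : du.
rewrite (near_eq_derive _ (dE v)) (near_eq_derive _ (dE w)).
apply: derive_comm_real; [|exact: da|exact: da].
by apply: filterS df => y /differentiable_mxP.
Qed.

End MixedDerivatives.

(** * Closure properties of smooth functions on an open set *)

Section SmoothFunctions.
Variables (R : realType) (V W : normedModType R).

Lemma smooth_on_differentiable (U : set V) (f : V -> W) x :
  smooth_on U f -> U x -> differentiable f x.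
Proof. by move=> /(_ [::]); exact. Qed.

(** Under [foldr] the last direction of the list is differentiated first, whence [rcons]. *)
Lemma smooth_on_derive (U : set V) (f : V -> W) v :
  smooth_on U f -> smooth_on U ('D_v f).
Proof. by move=> sf vs x Ux; have := sf (rcons vs v) x Ux; rewrite /iter_derive foldr_rcons. Qed.

Lemma smooth_on_near (U : set V) (f : V -> W) x :
  open U -> smooth_on U f -> U x -> \forall y \near x, differentiable f y.
Proof.
move=> oU sf Ux; apply: filterS (open_nbhs_nbhs (conj oU Ux)) => y.
exact: smooth_on_differentiable.
Qed.

(** A coinduction principle: by induction on the directions, each iterated derivative of a member of
    [P] agrees on [U] with a member of [P]. Since [U] is open, agreement on [U] is agreement of
    germs, which transfers both differentiability and the next derivative. *)
Lemma smooth_on_coind (U : set V) (P : (V -> W) -> Prop) : open U ->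
  (forall f, P f -> (forall x, U x -> differentiable f x) /\
     forall v, exists2 g, P g & forall x, U x -> 'D_v f x = g x) ->
  forall f, P f -> smooth_on U f.
Proof.
move=> oU PU f Pf vs.
have UN x : U x -> \forall y \near x, U y.
  by move=> Ux; apply: open_nbhs_nbhs; split.
suff [g Pg fg] : exists2 g, P g & forall x, U x -> iter_derive vs f x = g x.
  move=> x Ux; apply: near_eq_differentiable ((PU _ Pg).1 _ Ux).
  by apply: filterS (UN x Ux) => y /fg.
elim: vs => [|v vs [g Pg fg]]; first by exists f.
have [dg /(_ v)[h Ph gh]] := PU _ Pg.
exists h => // x Ux; rewrite -gh//=; apply: near_eq_derive.
by apply: filterS (UN x Ux) => y /fg.
Qed.

Lemma smooth_on_linear (U : set V) (L : {linear V -> W}) : open U ->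
  continuous L -> smooth_on U L.
Proof.
(* The derivative of [L] along [v] is the constant [L v], so the constants have to be added to close
   the class. *)
move=> oU cL; pose P (f : V -> W) := (exists c, f = cst c) \/ f = L.
apply: (@smooth_on_coind U P) => //; last by right.
move=> f [[c ->]|->]; split.
- by move=> x _; exact: differentiable_cst.
- by move=> v; exists (cst 0); [left; exists 0|move=> x _; exact: derive_cst].
- by move=> x _; exact: linear_differentiable.
- by move=> v; exists (cst (L v)); [left; exists (L v)|move=> x _; exact: derive_linear].
Qed.

End SmoothFunctions.

Section SmoothCompLinear.
Variables (R : realType) (V' V W : normedModType R).

Lemma smooth_on_comp_linear (U : set V) (f : V -> W) (L : {linear V' -> V}) :
  open U -> continuous L -> smooth_on U f -> smooth_on (L @^-1` U) (f \o L).
Proof.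
move=> oU cL sf; pose P (h : V' -> W) := exists2 f : V -> W, smooth_on U f & h = f \o L.
apply: (@smooth_on_coind _ _ _ _ P); last by exists f.
  by apply: open_comp => // x _; exact: cL.
move=> _ [{sf}g sg ->]; split=> [x Ux|v].
  apply: differentiable_comp; first exact: linear_differentiable.
  exact: (smooth_on_differentiable sg Ux).
exists ('D_(L v) g \o L); first by exists ('D_(L v) g) => //; exact: smooth_on_derive.
move=> x Ux; rewrite derive_compose ?derive_linear//.
  exact: linear_differentiable.
exact: (smooth_on_differentiable sg Ux).
Qed.

End SmoothCompLinear.

Section SmoothAlgebra.
Variables (R : realType) (V : normedModType R) (U : set V).
Hypothesis oU : open U.

(** The class for [smooth_on_coind]: by the Leibniz rule the derivative of a product is a sum of
    products, so sums and products must be closed up together. *)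
Inductive smooth_algebra : (V -> R) -> Prop :=
| smooth_algebra_base f : smooth_on U f -> smooth_algebra f
| smooth_algebra_cst (c : R) : smooth_algebra (cst c)
| smooth_algebraD f g :
    smooth_algebra f -> smooth_algebra g -> smooth_algebra (f \+ g)
| smooth_algebraM f g :
    smooth_algebra f -> smooth_algebra g -> smooth_algebra (f \* g).

Lemma smooth_algebra_smooth f : smooth_algebra f -> smooth_on U f.
Proof.
apply: smooth_on_coind => // {}f.
elim=> {f} [f sf|c|f g _ [df Df] _ [dg Dg]|f g Af [df Df] Ag [dg Dg]].
- split=> [x Ux|v]; first exact: (smooth_on_differentiable sf Ux).
  by exists ('D_v f) => //; apply: smooth_algebra_base; exact: smooth_on_derive.
- split=> [x _|v]; first exact: differentiable_cst.
  by exists (cst 0) => [|x _]; [exact: smooth_algebra_cst|exact: derive_cst].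
- split=> [x Ux|v]; first by apply: differentiableD; [exact: df|exact: dg].
  have [[f' Af' ff'] [g' Ag' gg']] := (Df v, Dg v).
  exists (f' \+ g') => [|x Ux]; first exact: smooth_algebraD.
  by rewrite deriveD /= ?ff' ?gg'//; apply: diff_derivable; [exact: df|exact: dg].
- split=> [x Ux|v]; first by apply: differentiableM; [exact: df|exact: dg].
  have [[f' Af' ff'] [g' Ag' gg']] := (Df v, Dg v).
  exists ((f \* g') \+ (g \* f')) => [|x Ux].
    by apply: smooth_algebraD; apply: smooth_algebraM.
  by rewrite deriveM /= ?ff' ?gg'//; apply: diff_derivable; [exact: df|exact: dg].
Qed.

Lemma smooth_on_cst (c : R) : smooth_on U (fun=> c).
Proof. exact/smooth_algebra_smooth/smooth_algebra_cst. Qed.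

Lemma smooth_onD (f g : V -> R) :
  smooth_on U f -> smooth_on U g -> smooth_on U (fun x => f x + g x).
Proof.
by move=> sf sg; apply/smooth_algebra_smooth/smooth_algebraD; exact: smooth_algebra_base.
Qed.

Lemma smooth_onM (f g : V -> R) :
  smooth_on U f -> smooth_on U g -> smooth_on U (fun x => f x * g x).
Proof.
by move=> sf sg; apply/smooth_algebra_smooth/smooth_algebraM; exact: smooth_algebra_base.
Qed.

Lemma smooth_onN (f : V -> R) : smooth_on U f -> smooth_on U (fun x => - f x).
Proof.
move=> sf; have -> : (fun x => - f x) = fun x => (- 1) * f x.
  by apply/funext => x; rewrite mulN1r.
by apply: smooth_onM => //; exact: smooth_on_cst.
Qed.

Lemma smooth_on_sum (I : finType) (f : I -> V -> R) :
  (forall i, smooth_on U (f i)) -> smooth_on U (fun x => \sum_i f i x).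
Proof.
move=> sf; have -> : (fun x => \sum_i f i x) = \sum_i f i.
  by apply/funext => x; rewrite fct_sumE.
elim/big_rec: _ => [|i g _ sg]; first exact: smooth_on_cst.
exact: smooth_onD.
Qed.

(** Both directions are coinductions, since ['D_v] is exchanged with taking an entry at points of
    differentiability, that is, on [U]. *)
Lemma smooth_on_mxP m n (M : V -> 'M[R]_(m, n)) :
  smooth_on U M <-> forall i j, smooth_on U (fun x => M x i j).
Proof.
split=> [sM i j|sM].
  pose P (f : V -> R) := exists2 N : V -> 'M[R]_(m, n), smooth_on U N & f = fun x => N x i j.
  apply: (@smooth_on_coind _ _ _ _ P) => //; last by exists M.
  move=> _ [N sN ->]; split=> [x Ux|v].
    by have /differentiable_mxP := smooth_on_differentiable sN Ux; exact.
  exists (fun x => 'D_v N x i j).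
    by exists ('D_v N) => //; exact: smooth_on_derive.
  by move=> x Ux; apply/esym/derive_coord; exact: (smooth_on_differentiable sN Ux).
pose P (N : V -> 'M[R]_(m, n)) := forall i j, smooth_on U (fun x => N x i j).
apply: (@smooth_on_coind _ _ _ _ P) => // N PN.
have dN x : U x -> differentiable N x.
  move=> Ux; apply/differentiable_mxP => i j.
  exact: (smooth_on_differentiable (PN i j) Ux).
split=> // v; exists (fun x => \matrix_(i, j) 'D_v (fun y => N y i j) x).
  move=> i j; under eq_fun do rewrite mxE; exact: smooth_on_derive.
by move=> x Ux; apply/matrixP => i j; rewrite mxE; apply: derive_coord; exact: dN.
Qed.

End SmoothAlgebra.

(** * The pairing of covectors with vectors, and derivatives along moving directions *)

Section LocalCalculus.
Variables (R : realType) (n : nat).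
Local Notation E := 'rV[R]_n.

(** Covectors and vectors are both encoded as rows; this is the duality pairing, with the covector
    usually on the left. *)
Definition dot (y v : E) : R := \sum_b y 0 b * v 0 b.

Lemma dotDr y v w : dot y (v + w) = dot y v + dot y w.
Proof. by rewrite /dot -big_split; apply: eq_bigr => b _; rewrite mxE mulrDr. Qed.

Lemma dotNr y v : dot y (- v) = - dot y v.
Proof. by rewrite /dot -sumrN; apply: eq_bigr => b _; rewrite mxE mulrN. Qed.

Lemma dotBr y v w : dot y (v - w) = dot y v - dot y w.
Proof. by rewrite dotDr dotNr. Qed.

Lemma dotZr y k v : dot y (k *: v) = k * dot y v.
Proof. by rewrite /dot mulr_sumr; apply: eq_bigr => b _; rewrite mxE mulrCA. Qed.

Lemma dot_sumr y (I : finType) (v : I -> E) :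
  dot y (\sum_i v i) = \sum_i dot y (v i).
Proof.
rewrite /dot exchange_big; apply: eq_bigr => b _.
by rewrite summxE mulr_sumr.
Qed.

Lemma row_basis (v : E) : v = \sum_a v 0 a *: basis_row R a.
Proof. exact: row_sum_delta. Qed.

Lemma dotDl (y y' v : E) : dot (y + y') v = dot y v + dot y' v.
Proof. by rewrite /dot -big_split; apply: eq_bigr => b _; rewrite mxE mulrDl. Qed.

Lemma dotNl (y v : E) : dot (- y) v = - dot y v.
Proof. by rewrite /dot -sumrN; apply: eq_bigr => b _; rewrite mxE mulNr. Qed.

Lemma dotZl k (y v : E) : dot (k *: y) v = k * dot y v.
Proof. by rewrite /dot mulr_sumr; apply: eq_bigr => b _; rewrite mxE mulrA. Qed.

Lemma dot0l (v : E) : dot 0 v = 0.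
Proof. by rewrite -(scale0r 0) dotZl mul0r. Qed.

Lemma dot0r (v : E) : dot v 0 = 0.
Proof. by rewrite -(scale0r 0) dotZr mul0r. Qed.

Lemma dot_suml (I : finType) (y : I -> E) v :
  dot (\sum_i y i) v = \sum_i dot (y i) v.
Proof.
rewrite /dot exchange_big; apply: eq_bigr => b _.
by rewrite summxE mulr_suml.
Qed.

Lemma dot_basis (v : E) b : dot (basis_row R b) v = v 0 b.
Proof.
rewrite /dot (bigD1 b)//= big1 => [|c cb]; first by rewrite mxE !eqxx mul1r addr0.
by rewrite mxE (negbTE cb) andbF mul0r.
Qed.

Lemma derive_partial (W : normedModType R) (f : E -> W) x v :
  differentiable f x -> 'D_v f x = \sum_a v 0 a *: partial f a x.
Proof.
move=> df; rewrite [in LHS](row_basis v) derive_sumdir//.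
by apply: eq_bigr => a _; rewrite deriveZdir.
Qed.

Lemma lie_bracket_locE (X Y : E -> E) x :
  differentiable X x -> differentiable Y x ->
  lie_bracket_loc X Y x = 'D_(X x) Y x - 'D_(Y x) X x.
Proof.
move=> dX dY; rewrite (derive_partial _ dX) (derive_partial _ dY).
apply/rowP => a; rewrite !mxE !summxE -sumrB.
by apply: eq_bigr => b _; rewrite !mxE.
Qed.

Section Products.
Variable V : normedModType R.

Lemma differentiable_scale (k : V -> R) (F : V -> E) x :
  differentiable k x -> differentiable F x -> differentiable (fun y => k y *: F y) x.
Proof.
move=> dk dF; apply/differentiable_mxP => i j.
have -> : (fun y => (k y *: F y) i j) = k * (fun y => F y i j).
  by apply/funext => y; rewrite mxE.
by apply: differentiableM => //; move/differentiable_mxP : dF.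
Qed.

Lemma derive_scale (k : V -> R) (F : V -> E) x v :
  differentiable k x -> differentiable F x ->
  'D_v (fun y => k y *: F y) x = 'D_v k x *: F x + k x *: 'D_v F x.
Proof.
move=> dk dF; apply/rowP => a.
have dFa : differentiable (fun y => F y 0 a) x by move/differentiable_mxP : dF.
transitivity ('D_v (fun y => (k y *: F y) 0 a) x).
  by apply: derive_coord; exact: differentiable_scale.
have -> : (fun y => (k y *: F y) 0 a) = k * (fun y => F y 0 a).
  by apply/funext => y; rewrite mxE.
rewrite deriveM; [|exact: diff_derivable|exact: diff_derivable].
rewrite !mxE; apply: etrans (addrC _ _) _; congr (_ + _); first exact: mulrC.
by congr (_ * _); exact/esym/derive_coord.
Qed.

Lemma differentiable_dot (Y F : V -> E) x :
  differentiable Y x -> differentiable F x ->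
  differentiable (fun z => dot (Y z) (F z)) x.
Proof.
move=> /differentiable_mxP dY /differentiable_mxP dF.
by apply: differentiable_fun_sum => b; exact: differentiableM.
Qed.

Lemma derive_dot (Y F : V -> E) x v :
  differentiable Y x -> differentiable F x ->
  'D_v (fun z => dot (Y z) (F z)) x = dot ('D_v Y x) (F x) + dot (Y x) ('D_v F x).
Proof.
move=> dY dF.
have dYb b : differentiable (fun y => Y y 0 b) x by move/differentiable_mxP : dY.
have dFb b : differentiable (fun y => F y 0 b) x by move/differentiable_mxP : dF.
rewrite derive_fun_sum; last by move=> b; exact: differentiableM.
rewrite /dot -big_split; apply: eq_bigr => b _ /=.
rewrite (@deriveM _ _ (fun y => Y y 0 b) (fun y => F y 0 b));
  [|exact: diff_derivable|exact: diff_derivable].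
apply: etrans (addrC _ _) _; congr (_ + _); last by congr (_ * _); exact/esym/derive_coord.
by apply: etrans (mulrC _ _) _; congr (_ * _); exact/esym/derive_coord.
Qed.

End Products.

Lemma differentiable_along (U : set E) (f : E -> E) (Z : E -> E) x :
  open U -> smooth_on U f -> U x -> differentiable Z x ->
  differentiable (fun y => 'D_(Z y) f y) x.
Proof.
move=> oU sf Ux dZ.
apply: (@near_eq_differentiable _ _ _ (fun y => \sum_a Z y 0 a *: partial f a y)).
  by apply: filterS (smooth_on_near oU sf Ux) => y dy; exact/esym/derive_partial.
apply: differentiable_fun_sum => a; apply: differentiable_scale.
  by move/differentiable_mxP : dZ.
exact: smooth_on_differentiable (smooth_on_derive (basis_row R a) sf) Ux.
Qed.

(** Near [x] the function is the sum of the [Z y 0 a *: partial f a y]. The Leibniz rule leaves the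
    derivatives along [v] of the [partial f a]; by [derive_comm] these are partial derivatives of
    ['D_v f], and they reassemble into a derivative along [Z x]. *)
Lemma derive_along (U : set E) (f : E -> E) (Z : E -> E) x v :
  open U -> smooth_on U f -> U x -> differentiable Z x ->
  'D_v (fun y => 'D_(Z y) f y) x = 'D_('D_v Z x) f x + 'D_(Z x) ('D_v f) x.
Proof.
move=> oU sf Ux dZ; have sfN := smooth_on_near oU sf Ux.
have dD u : differentiable ('D_u f) x.
  exact: smooth_on_differentiable (smooth_on_derive u sf) Ux.
have dZa a : differentiable (fun y => Z y 0 a) x by move/differentiable_mxP : dZ.
transitivity ('D_v (fun y => \sum_a Z y 0 a *: partial f a y) x).
  by apply: near_eq_derive; apply: filterS sfN => y dy; exact: derive_partial.
rewrite derive_fun_sum; last first.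
  by move=> a; apply: differentiable_scale; [exact: dZa|exact: dD].
rewrite (derive_partial _ (smooth_on_differentiable sf Ux)).
rewrite (derive_partial _ (dD v)) -big_split; apply: eq_bigr => a _ /=.
transitivity ('D_v (fun y => Z y 0 a) x *: partial f a x + Z x 0 a *: 'D_v (partial f a) x).
  by apply: derive_scale; [exact: dZa|exact: dD].
have e1 : 'D_v (fun y => Z y 0 a) x = 'D_v Z x 0 a by apply/esym/derive_coord.
have e2 : 'D_v (partial f a) x = partial ('D_v f) a x.
  exact: derive_comm sfN (dD (basis_row R a)) (dD v).
exact: (f_equal2 (fun c F => c *: partial f a x + Z x 0 a *: F) e1 e2).
Qed.

Lemma derive_related (U : set E) (g X Y : E -> E) p v :
  open U -> smooth_on U g -> U p -> differentiable X p -> differentiable Y (g p) ->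
  (forall q, U q -> Y (g q) = 'D_(X q) g q) ->
  'D_('D_v X p) g p + 'D_(X p) ('D_v g) p = 'D_('D_v g p) Y (g p).
Proof.
move=> oU sg Up dX dY XY; rewrite -(derive_along v oU sg Up dX).
transitivity ('D_v (Y \o g) p).
  apply: near_eq_derive; apply: filterS (open_nbhs_nbhs (conj oU Up)) => q Uq.
  by rewrite /= XY.
by apply: derive_compose => //; exact: smooth_on_differentiable sg Up.
Qed.

End LocalCalculus.

Section ProductDerivatives.
Variables (R : realType) (V W Z : normedModType R).

Lemma continuous_fst : continuous (@fst V W).
Proof. by move=> [x y]; exact: cvg_fst. Qed.

Lemma continuous_snd : continuous (@snd V W).
Proof. by move=> [x y]; exact: cvg_snd. Qed.

Lemma differentiable_comp_fst (f : V -> Z) (u : V * W) :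
  differentiable f u.1 -> differentiable (fun y : V * W => f y.1) u.
Proof.
move=> df; apply: (@differentiable_comp _ _ _ _ (@fst V W) f) => //.
by apply: linear_differentiable; exact: continuous_fst.
Qed.

Lemma derive_comp_fst (f : V -> Z) (u : V * W) v w :
  differentiable f u.1 -> 'D_((v, w) : V * W) (fun y : V * W => f y.1) u = 'D_v f u.1.
Proof.
move=> df; rewrite (@derive_compose _ _ _ _ (@fst V W) f)//.
  by congr ('D_ _ f _); apply: (@derive_linear _ _ _ (@fst V W)); exact: continuous_fst.
by apply: linear_differentiable; exact: continuous_fst.
Qed.

Lemma differentiable_snd (u : V * W) : differentiable (@snd V W) u.
Proof. by apply: linear_differentiable; exact: continuous_snd. Qed.

Lemma derive_snd (u : V * W) v w : 'D_((v, w) : V * W) (@snd V W) u = w.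
Proof. by apply: (@derive_linear _ _ _ (@snd V W)); exact: continuous_snd. Qed.

End ProductDerivatives.

(** * Transformation laws under a change of charts *)

Section RelatedFields.
Variables (R : realType) (n : nat).
Local Notation E := 'rV[R]_n.

(** The fibre component pairs the covector with [partial g a] at the image point. It varies with the
    covector, at rate [eta], and with the image point, at rate ['D_xi f u.1]. *)
Lemma derive_cot_map (f g : E -> E) (u : E * E) xi eta :
  differentiable f u.1 -> (forall a, differentiable (partial g a) (f u.1)) ->
  'D_((xi, eta) : E * E) (cot_map f g) u =
    ('D_xi f u.1, \row_a (dot eta (partial g a (f u.1)) +
       dot u.2 ('D_('D_xi f u.1) (partial g a) (f u.1)))).
Proof.
move=> df dg.
pose C (y : E * E) : E := \row_a dot y.2 (partial g a (f y.1)).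
have dF a : differentiable (fun y : E * E => partial g a (f y.1)) u.
  by apply: (@differentiable_comp_fst _ _ _ _ (partial g a \o f)); exact: differentiable_comp.
have CE a : (fun y => C y 0 a) = fun y => dot y.2 (partial g a (f y.1)).
  by apply/funext => y; rewrite mxE.
have dC : differentiable C u.
  apply/differentiable_mxP => i a; rewrite (ord1 i) CE.
  by apply: differentiable_dot => //; exact: differentiable_snd.
transitivity ('D_((xi, eta) : E * E) (fun y : E * E => (f y.1, C y)) u) => //.
rewrite derive_pair//; last exact: differentiable_comp_fst.
apply: (f_equal2 pair); first exact: (derive_comp_fst xi eta df).
apply/rowP => a; rewrite mxE.
apply: etrans (derive_coord (xi, eta) 0 a dC) _.
apply: (etrans (f_equal (fun h => 'D_((xi, eta) : E * E) h u) (CE a))).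
apply: etrans (derive_dot _ (differentiable_snd u) (dF a)) _.
have e1 := derive_snd u xi eta.
have e2 : 'D_((xi, eta) : E * E) (fun y : E * E => partial g a (f y.1)) u =
    'D_('D_xi f u.1) (partial g a) (f u.1).
  apply: etrans (derive_compose xi df (dg a)).
  apply: (@derive_comp_fst _ _ _ _ (partial g a \o f)).
  exact: differentiable_comp.
exact: (f_equal2 (fun v w => dot v (partial g a (f u.1)) + dot u.2 w) e1 e2).
Qed.

(** The row on the left is the pullback of [y] by [g]; the transposed Jacobian is moved from the
    covector onto the vector. *)
Lemma dot_pullback (g : E -> E) p y w : differentiable g p ->
  dot (\row_b dot y (partial g b p)) w = dot y ('D_w g p).
Proof.
move=> dg; rewrite (derive_partial _ dg) dot_sumr; apply: eq_bigr => b _.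
by rewrite mxE dotZr mulrC.
Qed.

Section LocalDiffeomorphism.
Variables (U U' : set E) (f g X X' : E -> E).
Hypotheses (oU : open U) (oU' : open U').
Hypotheses (sf : smooth_on U f) (sg : smooth_on U' g).
Hypotheses (fU : forall x, U x -> U' (f x)) (fK : forall x, U x -> g (f x) = x).
Hypotheses (sX : smooth_on U X) (sX' : smooth_on U' X').
Hypothesis gX : forall p, U' p -> X (g p) = 'D_(X' p) g p.
Hypothesis fX : forall x, U x -> X' (f x) = 'D_(X x) f x.

Let dg x : U x -> differentiable g (f x).
Proof. by move=> /fU; exact: smooth_on_differentiable. Qed.

Let dDg v x : U x -> differentiable ('D_v g) (f x).
Proof. by move=> /fU; apply: smooth_on_differentiable; exact: smooth_on_derive. Qed.

(** This is [derive_related] for [g], which carries [X'] to [X], in the coordinate direction [a];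
    [fK] identifies the point [g (f x)] with [x]. *)
Let key x a : U x ->
  'D_(partial X' a (f x)) g (f x) + 'D_(X' (f x)) (partial g a) (f x) =
  'D_(partial g a (f x)) X x.
Proof.
move=> Ux; have Ufx := fU Ux.
rewrite -[X in _ = 'D_ _ _ X](fK Ux); apply: (derive_related _ oU' sg Ufx _ _ gX).
  exact: smooth_on_differentiable sX' Ufx.
by rewrite (fK Ux); exact: smooth_on_differentiable sX Ux.
Qed.

(** By [dot_pullback], the fibre on the left pairs [- y] with ['D_(partial X' a) g]. On the right,
    the moving covector gives [- y] against ['D_(partial g a) X], and the moving point gives [y]
    against ['D_X' (partial g a)]. The identity [key] balances the three terms. *)
Lemma cotangent_lift_related (u : E * E) : U u.1 ->
  (base (cotangent_lift_loc X') (f u.1),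
   fibre (cotangent_lift_loc X') (cot_map f g u)) =
  'D_((base (cotangent_lift_loc X) u.1,
       fibre (cotangent_lift_loc X) u) : E * E) (cot_map f g) u.
Proof.
move=> Uu; rewrite derive_cot_map /=; first last.
- by move=> a; exact: dDg.
- exact: smooth_on_differentiable sf Uu.
rewrite -fX//; apply: (f_equal2 pair) => //; apply/rowP => a; rewrite !mxE.
rewrite -/(dot _ (partial X' a (f u.1))) dot_pullback; last exact: dg.
have -> : (\row_b - \sum_c u.2 0 c * partial X b u.1 0 c) =
    \row_b dot (- u.2) (partial X b u.1).
  by apply/rowP => b; rewrite !mxE -sumrN; apply: eq_bigr => c _; rewrite mxE mulNr.
rewrite dot_pullback; last exact: smooth_on_differentiable sX Uu.
rewrite -(key a Uu) dotDr.
by rewrite !dotNl subrK.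
Qed.

Lemma vertical_rep_related (z : E * E * 'M[R]_n) : U z.1.1 ->
  (base (vertical_rep_loc (cotangent_lift_loc X')) (f z.1.1),
   fibre (vertical_rep_loc (cotangent_lift_loc X')) (jet1_map f g z)) =
  'D_((base (vertical_rep_loc (cotangent_lift_loc X)) z.1.1,
       fibre (vertical_rep_loc (cotangent_lift_loc X)) z) : E * E) (cot_map f g) z.1.
Proof.
case: z => -[x y] m /= Ux; have Ufx := fU Ux.
rewrite derive_cot_map /=; first last.
- by move=> a; exact: dDg.
- exact: smooth_on_differentiable sf Ux.
rewrite derive0; apply: (f_equal2 pair) => //; apply/rowP => a; rewrite !mxE.
have -> : dot y ('D_0 (partial g a) (f x)) = 0 by rewrite derive0 dot0r.
rewrite addr0 -/(dot _ (partial X' a (f x))) dot_pullback; last exact: dg.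
(* The transformed jet contracted with [X']. In the part linear in [m], the sum of [X'^b] times
   [partial g b] is [X x] by [gX]; the part linear in [y] is the second derivative of [g] that [key]
   requires, a term which for the lift itself came from the motion of the base point. *)
have -> : \sum_b X' (f x) 0 b * (\matrix_(a0, b0)
    (\sum_c \sum_d m c d * partial g b0 (f x) 0 d * partial g a0 (f x) 0 c +
     \sum_c y 0 c * partial (partial g a0) b0 (f x) 0 c)) a b =
  \sum_c dot (row c m) (X x) * partial g a (f x) 0 c +
  dot y ('D_(X' (f x)) (partial g a) (f x)).
  rewrite (derive_partial _ (dDg _ Ux)) dot_sumr.
  under eq_bigr => b _ do rewrite mxE mulrDr.
  rewrite big_split; congr (_ + _); last first.
    by apply: eq_bigr => b _; rewrite dotZr.
  have -> : X x = \sum_b X' (f x) 0 b *: partial g b (f x).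
    by rewrite -(derive_partial _ (dg Ux)) -gX// fK.
  under [LHS]eq_bigr => b _ do rewrite mulr_sumr.
  rewrite exchange_big; apply: eq_bigr => c _ /=.
  rewrite dot_sumr mulr_suml; apply: eq_bigr => b _.
  rewrite dotZr -mulrA; congr (_ * _); rewrite mulr_suml; apply: eq_bigr => d _.
  by rewrite !mxE.
rewrite [RHS](_ : _ = - dot y ('D_(partial g a (f x)) X x) -
    \sum_c dot (row c m) (X x) * partial g a (f x) 0 c); last first.
  rewrite -(dot_pullback _ _ (smooth_on_differentiable sX Ux)).
  rewrite -sumrN /dot -sumrN -big_split; apply: eq_bigr => c _ /=.
  rewrite !mxE mulrBl mulNr; congr (_ - _ * _).
  by apply: eq_bigr => d _; rewrite mxE mulrC.
rewrite -(key a Ux) dotDr; ring.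
Qed.

End LocalDiffeomorphism.

Lemma lie_bracket_related (U U' : set E) (f X X' Y Y' : E -> E) x :
  open U -> smooth_on U f -> U x -> U' (f x) ->
  smooth_on U X -> smooth_on U' X' -> smooth_on U Y -> smooth_on U' Y' ->
  (forall q, U q -> X' (f q) = 'D_(X q) f q) ->
  (forall q, U q -> Y' (f q) = 'D_(Y q) f q) ->
  lie_bracket_loc X' Y' (f x) = 'D_(lie_bracket_loc X Y x) f x.
Proof.
move=> oU sf Ux Ufx sX sX' sY sY' fX fY.
have dX := smooth_on_differentiable sX Ux.
have dY := smooth_on_differentiable sY Ux.
have dX' := smooth_on_differentiable sX' Ufx.
have dY' := smooth_on_differentiable sY' Ufx.
have df := smooth_on_differentiable sf Ux.
have cancel (a b c d : E) : c = d -> (a + c) - (b + d) = a - b.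
  by move=> ->; rewrite opprD addrACA subrr addr0.
have dDf v : differentiable ('D_v f) x.
  exact: smooth_on_differentiable (smooth_on_derive v sf) Ux.
(* Each of [X'], [Y'] is differentiated along the other. The two results contain the second
   derivative of [f] along [X x] and [Y x], in opposite orders, and it cancels in their
   difference. *)
have kX := etrans (f_equal (fun v => 'D_v X' (f x)) (fY _ Ux))
  (esym (derive_related (Y x) oU sf Ux dX dX' fX)).
have kY := etrans (f_equal (fun v => 'D_v Y' (f x)) (fX _ Ux))
  (esym (derive_related (X x) oU sf Ux dY dY' fY)).
have comm := derive_comm (smooth_on_near oU sf Ux) (dDf (X x)) (dDf (Y x)).
rewrite (lie_bracket_locE dX' dY') (lie_bracket_locE dX dY).
apply: etrans (esym (deriveBdir _ _ df)).
apply: etrans (f_equal2 (fun u v => u - v) kY kX) _.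
exact: cancel comm.
Qed.

End RelatedFields.

(** * Smoothness, linearity and injectivity of the lifts in one chart *)

Section VerticalRepresentative.
Variables (R : realType) (n : nat).
Local Notation E := 'rV[R]_n.
Local Notation J1 := (E * E * 'M[R]_n)%type.
Local Notation vlift X := (vertical_rep_loc (cotangent_lift_loc X)).

Lemma fibre_cotangent_lift (X : E -> E) (u : E * E) a :
  fibre (cotangent_lift_loc X) u 0 a = - dot u.2 (partial X a u.1).
Proof. by rewrite mxE. Qed.

Lemma fibre_vertical_lift (X : E -> E) (z : J1) a :
  fibre (vlift X) z 0 a = - dot z.1.2 (partial X a z.1.1) - dot (X z.1.1) (row a z.2).
Proof. by rewrite !mxE; congr (_ - _); apply: eq_bigr => b _; rewrite mxE. Qed.

Lemma smooth_on_cotangent_lift (U : set E) (X : E -> E) : open U -> smooth_on U X ->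
  smooth_on [set u : E * E | U u.1] (fibre (cotangent_lift_loc X)).
Proof.
move=> oU sX.
have oU1 : open [set u : E * E | U u.1].
  by apply: (open_comp (f := @fst E E)) => // x _; exact: continuous_fst.
apply/(smooth_on_mxP oU1) => i a; rewrite (ord1 i).
rewrite (_ : (fun u => _) = fun u : E * E => - dot u.2 (partial X a u.1)); last first.
  by apply/funext => u; exact: fibre_cotangent_lift.
apply: smooth_onN => //; apply: smooth_on_sum => // b; apply: smooth_onM => //.
  have : smooth_on [set u : E * E | U u.1] (@snd E E).
    by apply: smooth_on_linear => //; exact: continuous_snd.
  by move=> /(smooth_on_mxP oU1); exact.
have : smooth_on [set u : E * E | U u.1] (partial X a \o @fst E E).
  apply: smooth_on_comp_linear => //; first exact: continuous_fst.
  exact: smooth_on_derive.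
by move=> /(smooth_on_mxP oU1); exact.
Qed.

Lemma smooth_on_vertical_lift (U : set E) (X : E -> E) : open U -> smooth_on U X ->
  smooth_on [set z : J1 | U z.1.1] (fibre (vlift X)).
Proof.
move=> oU sX.
have oU1 : open [set u : E * E | U u.1].
  by apply: (open_comp (f := @fst E E)) => // x _; exact: continuous_fst.
have oU2 : open [set z : J1 | U z.1.1].
  by apply: (open_comp (f := @fst (E * E)%type 'M[R]_n)) oU1 => x _; exact: continuous_fst.
apply/(smooth_on_mxP oU2) => i a; rewrite (ord1 i).
pose G := fibre (cotangent_lift_loc X).
have sG : smooth_on [set z : J1 | U z.1.1] (G \o @fst (E * E)%type 'M[R]_n).
  apply: (smooth_on_comp_linear oU1); first exact: continuous_fst.
  exact: smooth_on_cotangent_lift.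
have sX1 : smooth_on [set z : J1 | U z.1.1] ((X \o @fst E E) \o @fst (E * E)%type 'M[R]_n).
  apply: (smooth_on_comp_linear oU1); first exact: continuous_fst.
  by apply: smooth_on_comp_linear => //; exact: continuous_fst.
have s2 : smooth_on [set z : J1 | U z.1.1] (@snd (E * E)%type 'M[R]_n).
  by apply: smooth_on_linear => //; exact: continuous_snd.
rewrite (_ : (fun z => _) = fun z : J1 =>
    G z.1 0 a + - \sum_b X z.1.1 0 b * z.2 a b); last first.
  by apply/funext => z; rewrite mxE.
apply: smooth_onD => //; first by move/(smooth_on_mxP oU2) : sG; exact.
apply: smooth_onN => //; apply: smooth_on_sum => // b; apply: smooth_onM => //.
  by move/(smooth_on_mxP oU2) : sX1; exact.
by move/(smooth_on_mxP oU2) : s2; exact.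
Qed.

Lemma smooth_on_lie_bracket (U : set E) (X Y : E -> E) : open U ->
  smooth_on U X -> smooth_on U Y -> smooth_on U (lie_bracket_loc X Y).
Proof.
move=> oU sX sY; apply/(smooth_on_mxP oU) => i a; rewrite (ord1 i).
rewrite (_ : (fun x => _) = fun x => \sum_b
    (X x 0 b * partial Y b x 0 a + - (Y x 0 b * partial X b x 0 a))); last first.
  by apply/funext => x; rewrite mxE.
have sp (Z : E -> E) b : smooth_on U Z -> smooth_on U (fun x => partial Z b x 0 a).
  by move=> /(smooth_on_derive (basis_row R b))/(smooth_on_mxP oU); exact.
have sc (Z : E -> E) b : smooth_on U Z -> smooth_on U (fun x : E => Z x 0 b : R).
  by move=> /(smooth_on_mxP oU); exact.
apply: smooth_on_sum => // b; apply: smooth_onD => //; last apply: smooth_onN => //.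
  by apply: smooth_onM => //; [exact: sc|exact: sp].
by apply: smooth_onM => //; [exact: sc|exact: sp].
Qed.

Lemma smooth_on_lincomb (U : set E) k (X Y : E -> E) : open U ->
  smooth_on U X -> smooth_on U Y -> smooth_on U (fun x => k *: X x + Y x).
Proof.
move=> oU /(smooth_on_mxP oU) sX /(smooth_on_mxP oU) sY.
apply/(smooth_on_mxP oU) => i a.
rewrite (_ : (fun x => _) = fun x => k * X x i a + Y x i a); last first.
  by apply/funext => x; rewrite !mxE.
by apply: smooth_onD => //; apply: smooth_onM => //; exact: smooth_on_cst.
Qed.

Lemma derive_lincomb k (X Y : E -> E) x v :
  differentiable X x -> differentiable Y x ->
  'D_v (fun y => k *: X y + Y y) x = k *: 'D_v X x + 'D_v Y x.
Proof.
move=> dX dY; rewrite -[LHS]/('D_v (k *: X + Y) x).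
rewrite deriveD; [|by apply/derivableZ/diff_derivable|exact: diff_derivable].
by congr (_ + _); apply: deriveZ; exact: diff_derivable.
Qed.

Lemma vertical_lift_lincomb k (X Y : E -> E) (z : J1) :
  differentiable X z.1.1 -> differentiable Y z.1.1 ->
  fibre (vlift (fun x => k *: X x + Y x)) z =
  k *: fibre (vlift X) z + fibre (vlift Y) z.
Proof.
move=> dX dY; apply/rowP => a; rewrite [RHS]mxE [X in _ = X + _]mxE.
apply: etrans (fibre_vertical_lift _ _ _) _.
apply: etrans (esym (f_equal2 (fun s t => k * s + t)
  (fibre_vertical_lift X z a) (fibre_vertical_lift Y z a))).
have dE : partial (fun x => k *: X x + Y x) a z.1.1 =
    k *: partial X a z.1.1 + partial Y a z.1.1 by exact: derive_lincomb.
apply: etrans (f_equal (fun d => - dot z.1.2 d - _) dE) _.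
by rewrite dotDr dotZr dotDl dotZl; ring.
Qed.

Lemma vertical_lift_inj (X Y : E -> E) x :
  (forall m, fibre (vlift X) ((x, 0, m) : J1) = fibre (vlift Y) ((x, 0, m) : J1)) ->
  X x = Y x.
Proof.
(* At the zero covector only the jet term survives, and row [b] of [delta_mx b b] is the basis row
   that selects the component [b]. *)
have vE (Z : E -> E) b : fibre (vlift Z) ((x, 0, delta_mx b b) : J1) 0 b = - Z x 0 b.
  rewrite fibre_vertical_lift /= dot0l oppr0 sub0r; congr (- _).
  rewrite -[RHS]dot_basis /dot; apply: eq_bigr => c _.
  by rewrite !mxE eqxx mulrC.
move=> XY; apply/rowP => b; apply: oppr_inj.
exact: (etrans (esym (vE X b)) (etrans (f_equal (fun r : E => r 0 b) (XY _)) (vE Y b))).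
Qed.

End VerticalRepresentative.

(** * The first prolongation of a vertical lift, and the bracket *)

Section ProlongationBracket.
Variables (R : realType) (n : nat).
Local Notation E := 'rV[R]_n.
Local Notation J1 := (E * E * 'M[R]_n)%type.
Local Notation vlift X := (vertical_rep_loc (cotangent_lift_loc X)).

Lemma derive_row (z : J1) v w (N : 'M[R]_n) a :
  differentiable (fun z : J1 => row a z.2) z /\
  'D_((v, w, N) : J1) (fun z : J1 => row a z.2) z = row a N.
Proof.
have d2 : differentiable (@snd (E * E)%type 'M[R]_n) z by exact: differentiable_snd.
have rE b : (fun z : J1 => row a z.2 0 b) = (fun z : J1 => z.2 a b).
  by apply/funext => y; rewrite mxE.
have dr : differentiable (fun z : J1 => row a z.2) z.
  apply/differentiable_mxP => i b; rewrite (ord1 i) rE.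
  by move/differentiable_mxP : d2; exact.
split=> //; apply/rowP => b; rewrite mxE.
apply: etrans (derive_coord _ 0 b dr) _.
apply: etrans (f_equal (fun h => 'D_((v, w, N) : J1) h z) (rE b)) _.
apply: etrans (esym (derive_coord _ a b d2)) _.
exact: (f_equal (fun M : 'M[R]_n => M a b) (derive_snd z (v, w) N)).
Qed.

(** One derivative in a general direction of the jet space; the partial derivatives in [x], [y] and
    [y1] follow by setting two of [v], [w], [N] to zero. *)
Lemma derive_vertical_lift (X : E -> E) a (z : J1) v w N :
  differentiable X z.1.1 -> differentiable (partial X a) z.1.1 ->
  'D_((v, w, N) : J1) (fun z => fibre (vlift X) z 0 a) z =
  - (dot w (partial X a z.1.1) + dot z.1.2 ('D_v (partial X a) z.1.1))
  - (dot ('D_v X z.1.1) (row a z.2) + dot (X z.1.1) (row a N)).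
Proof.
move=> dX dpX.
have [dr er] := derive_row z v w N a.
pose F := (fun z : J1 => dot z.1.2 (partial X a z.1.1)).
pose G := (fun z : J1 => dot (X z.1.1) (row a z.2)).
have d12 : differentiable (fun z : J1 => z.1.2) z.
  by apply: (@differentiable_comp_fst _ (E * E)%type _ _ snd); exact: differentiable_snd.
have dp : differentiable (fun z : J1 => partial X a z.1.1) z.
  apply: (@differentiable_comp_fst _ (E * E)%type _ _ (fun u => partial X a u.1)).
  exact: differentiable_comp_fst.
have dX1 : differentiable (fun z : J1 => X z.1.1) z.
  apply: (@differentiable_comp_fst _ (E * E)%type _ _ (fun u => X u.1)).
  exact: differentiable_comp_fst.
have e12 : 'D_((v, w, N) : J1) (fun z : J1 => z.1.2) z = w.
  apply: etrans (derive_snd z.1 v w).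
  by apply: (@derive_comp_fst _ (E * E)%type _ _ snd); exact: differentiable_snd.
have ep : 'D_((v, w, N) : J1) (fun z : J1 => partial X a z.1.1) z =
    'D_v (partial X a) z.1.1.
  apply: etrans (derive_comp_fst v w dpX).
  apply: (@derive_comp_fst _ (E * E)%type _ _ (fun u => partial X a u.1)).
  exact: differentiable_comp_fst.
have eX : 'D_((v, w, N) : J1) (fun z : J1 => X z.1.1) z = 'D_v X z.1.1.
  apply: etrans (derive_comp_fst v w dX).
  apply: (@derive_comp_fst _ (E * E)%type _ _ (fun u => X u.1)).
  exact: differentiable_comp_fst.
have eF : 'D_((v, w, N) : J1) F z =
    dot w (partial X a z.1.1) + dot z.1.2 ('D_v (partial X a) z.1.1).
  apply: etrans (derive_dot _ d12 dp) _.
  exact: (f_equal2 (fun p q => dot p (partial X a z.1.1) + dot z.1.2 q) e12 ep).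
have eG : 'D_((v, w, N) : J1) G z =
    dot ('D_v X z.1.1) (row a z.2) + dot (X z.1.1) (row a N).
  apply: etrans (derive_dot _ dX1 dr) _.
  exact: (f_equal2 (fun p q => dot p (row a z.2) + dot (X z.1.1) q) eX er).
have FG : (fun z => fibre (vlift X) z 0 a) = - F - G.
  by apply/funext => y; exact: fibre_vertical_lift.
have dF : differentiable F z by exact: differentiable_dot.
have dG : differentiable G z by exact: differentiable_dot.
apply: etrans (f_equal (fun h => 'D_((v, w, N) : J1) h z) FG) _.
have eB : 'D_((v, w, N) : J1) (- F - G) z =
    'D_((v, w, N) : J1) (- F) z - 'D_((v, w, N) : J1) G z.
  by apply: deriveB; apply: diff_derivable => //; exact: differentiableN.
apply: (etrans eB).
have eN : 'D_((v, w, N) : J1) (- F) z = - 'D_((v, w, N) : J1) F z.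
  by apply: deriveN; exact: diff_derivable.
exact: (f_equal2 (fun s t => s - t) (etrans eN (f_equal -%R eF)) eG).
Qed.

Section Partials.
Variables (X : E -> E) (a : 'I_n) (z : J1).
Hypotheses (dX : differentiable X z.1.1) (dpX : differentiable (partial X a) z.1.1).
Let F := fun z : J1 => fibre (vlift X) z 0 a.

Lemma partial_x_vertical_lift b : partial_x F b z =
  - dot z.1.2 (partial (partial X a) b z.1.1) - dot (partial X b z.1.1) (row a z.2).
Proof.
apply: etrans (derive_vertical_lift _ _ _ dX dpX) _.
by rewrite dot0l add0r row0 dot0r addr0.
Qed.

Lemma partial_y_vertical_lift b : partial_y F b z = - partial X a z.1.1 0 b.
Proof.
apply: etrans (derive_vertical_lift _ _ _ dX dpX) _.
by rewrite !derive0 row0 !dot0r dot0l !addr0 subr0 dot_basis.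
Qed.

Lemma partial_y1_vertical_lift c d :
  partial_y1 F c d z = - ((a == c)%:R * X z.1.1 0 d).
Proof.
apply: etrans (derive_vertical_lift _ _ _ dX dpX) _.
rewrite !derive0 !dot0l dot0r !add0r oppr0 add0r; congr (- _).
have -> : row a (delta_mx c d) = (a == c)%:R *: basis_row R d.
  by apply/rowP => b; rewrite !mxE !eqxx /= -natrM mulnb.
rewrite dotZr -dot_basis; congr (_ * _).
by apply: eq_bigr => b _; rewrite mulrC.
Qed.

End Partials.

Lemma sum_delta (a : 'I_n) (f : 'I_n -> R) : \sum_c (a == c)%:R * f c = f a.
Proof.
rewrite (bigD1 a)//= eqxx mul1r big1 ?addr0// => c ca.
by rewrite eq_sym (negbTE ca) mul0r.
Qed.

Lemma prolongation_coef_vertical_lift (X : E -> E) x y m y2 a d :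
  differentiable X x -> differentiable (partial X a) x ->
  prolongation_coef (vlift X) a d (x, y, m, y2) =
  - (dot y (partial (partial X a) d x) + dot (partial X d x) (row a m)
     + \sum_b m b d * partial X a x 0 b + \sum_c y2 a c d * X x 0 c).
Proof.
move=> dX dpX; rewrite /prolongation_coef.
(* A vertical field has zero base component, so its prolongation coefficient is just the total
   derivative of its fibre component. *)
have -> : (fun z : J1 => fibre (vlift X) z 0 a -
    \sum_c base (vlift X) z.1.1 0 c * z.2 a c) = fun z => fibre (vlift X) z 0 a.
  by apply/funext => z; rewrite [X in _ - X]big1 ?subr0// => c _; rewrite mxE mul0r.
rewrite [X in _ + X]big1 ?addr0; last by move=> c _; rewrite mxE mul0r.
have hx := @partial_x_vertical_lift X a ((x, y, m) : J1) dX dpX d.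
have hy b := @partial_y_vertical_lift X a ((x, y, m) : J1) dX dpX b.
have hy1 b c := @partial_y1_vertical_lift X a ((x, y, m) : J1) dX dpX b c.
move: hx hy hy1; move: (fun z : J1 => fibre (vlift X) z 0 a) => F hx hy hy1.
have e1 : \sum_b m b d * partial_y F b (x, y, m) =
    - \sum_b m b d * partial X a x 0 b.
  by rewrite -sumrN; apply: eq_bigr => b _; rewrite hy mulrN.
have e2 : \sum_b \sum_c y2 b c d * partial_y1 F b c (x, y, m) =
    - \sum_c y2 a c d * X x 0 c.
  rewrite -(sum_delta a (fun b => \sum_c y2 b c d * X x 0 c)) -sumrN.
  apply: eq_bigr => b _; rewrite mulr_sumr -sumrN; apply: eq_bigr => c _.
  by rewrite hy1 mulrN mulrCA.
rewrite /total_derivative hx e1 e2 /=.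
by rewrite !opprD.
Qed.

(** The fibre components of [X] against the [y]-derivatives give ['D_(partial Y a x) X] and the
    first sum over rows of [m]. The [y1]-derivatives involve only the jets of index [a], with factor
    [- Y], so the prolongation coefficients give everything else. The grouping isolates the terms
    that an exchange of [X] and [Y] preserves. *)
Lemma prolongation_vertical_lift (X Y : E -> E) x y m y2 a :
  (forall b, differentiable (partial X b) x) -> differentiable X x ->
  differentiable Y x -> differentiable (partial Y a) x ->
  prolongation_apply (vlift X) (fun z => fibre (vlift Y) z 0 a) (x, y, m, y2) =
  dot y ('D_(partial Y a x) X x) + dot y ('D_(Y x) (partial X a) x)
  + dot ('D_(Y x) X x) (row a m)
  + (\sum_b dot (X x) (row b m) * partial Y a x 0 b
     + \sum_b dot (Y x) (row b m) * partial X a x 0 b)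
  + \sum_c \sum_d y2 a c d * X x 0 c * Y x 0 d.
Proof.
move=> dpX dX dY dpY; rewrite /prolongation_apply.
have hy b := @partial_y_vertical_lift Y a ((x, y, m) : J1) dY dpY b.
have hy1 b c := @partial_y1_vertical_lift Y a ((x, y, m) : J1) dY dpY b c.
rewrite [X in X + _ + _]big1 ?add0r; last by move=> c _; rewrite mxE mul0r.
move: hy hy1; move: (fun z : J1 => fibre (vlift Y) z 0 a) => F hy hy1.
have -> : \sum_b \sum_c prolongation_coef (vlift X) b c (x, y, m, y2) *
      partial_y1 F b c (x, y, m) =
    - \sum_c prolongation_coef (vlift X) a c (x, y, m, y2) * Y x 0 c.
  rewrite -(sum_delta a (fun b =>
    \sum_c prolongation_coef (vlift X) b c (x, y, m, y2) * Y x 0 c)) -sumrN.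
  apply: eq_bigr => b _; rewrite mulr_sumr -sumrN; apply: eq_bigr => c _.
  by rewrite hy1 mulrN mulrCA.
have -> : \sum_b fibre (vlift X) ((x, y, m) : J1) 0 b * partial_y F b (x, y, m) =
    - \sum_b fibre (vlift X) ((x, y, m) : J1) 0 b * partial Y a x 0 b.
  by rewrite -sumrN; apply: eq_bigr => b _; rewrite hy mulrN.
rewrite -sumrN -[X in _ + X]sumrN.
have -> : \sum_b - (fibre (vlift X) ((x, y, m) : J1) 0 b * partial Y a x 0 b) =
    dot y ('D_(partial Y a x) X x) + \sum_b dot (X x) (row b m) * partial Y a x 0 b.
  rewrite (derive_partial _ dX) dot_sumr -big_split; apply: eq_bigr => b _.
  by rewrite fibre_vertical_lift dotZr /=; ring.
have -> : \sum_d - (prolongation_coef (vlift X) a d (x, y, m, y2) * Y x 0 d) =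
    dot y ('D_(Y x) (partial X a) x) + dot ('D_(Y x) X x) (row a m)
    + \sum_b dot (Y x) (row b m) * partial X a x 0 b
    + \sum_c \sum_d y2 a c d * X x 0 c * Y x 0 d.
  rewrite (derive_partial _ dX) (derive_partial _ (dpX a)) dot_sumr dot_suml.
  under [X in _ + X + _]eq_bigr => b _ do rewrite mulr_suml.
  rewrite [X in _ + X + _]exchange_big [X in _ + X]exchange_big -!big_split.
  apply: eq_bigr => d _.
  rewrite prolongation_coef_vertical_lift// dotZr dotZl.
  have e1 : \sum_b Y x 0 d * row b m 0 d * partial X a x 0 b =
      Y x 0 d * \sum_b m b d * partial X a x 0 b.
    by rewrite mulr_sumr; apply: eq_bigr => b _; rewrite mxE mulrA.
  have e2 : \sum_c y2 a c d * X x 0 c * Y x 0 d =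
      (\sum_c y2 a c d * X x 0 c) * Y x 0 d by rewrite mulr_suml.
  by rewrite /= e1 e2; ring.
ring.
Qed.

(* The last two terms of [prolongation_vertical_lift] are symmetric in X and Y,
   the second of them because y_{a,cd} = y_{a,dc}, so they cancel. *)
Lemma pro_bracket_vertical_lift (U : set E) (X Y : E -> E) x y m y2 :
  open U -> smooth_on U X -> smooth_on U Y -> U x ->
  symmetric_jet ((x, y, m, y2) : jet2_space R n) ->
  fibre (vlift (lie_bracket_loc X Y)) ((x, y, m) : J1) =
  fibre (pro_bracket_loc (vlift X) (vlift Y)) (x, y, m, y2).
Proof.
move=> oU sX sY Ux sym; apply/rowP => a.
have dX := smooth_on_differentiable sX Ux.
have dY := smooth_on_differentiable sY Ux.
have dpX b : differentiable (partial X b) x.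
  exact: smooth_on_differentiable (smooth_on_derive (basis_row R b) sX) Ux.
have dpY b : differentiable (partial Y b) x.
  exact: smooth_on_differentiable (smooth_on_derive (basis_row R b) sY) Ux.
have dL : partial (lie_bracket_loc X Y) a x =
    ('D_(partial X a x) Y x + 'D_(X x) (partial Y a) x)
    - ('D_(partial Y a x) X x + 'D_(Y x) (partial X a) x).
  have dXY := differentiable_along oU sY Ux dX.
  have dYX := differentiable_along oU sX Ux dY.
  transitivity ('D_(basis_row R a)
      ((fun q => 'D_(X q) Y q) - (fun q => 'D_(Y q) X q)) x).
    apply: near_eq_derive; apply: filterS (open_nbhs_nbhs (conj oU Ux)) => q Uq.
    apply: lie_bracket_locE; [exact: smooth_on_differentiable sX Uq|].
    exact: smooth_on_differentiable sY Uq.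
  apply: etrans (deriveB (diff_derivable dXY) (diff_derivable dYX)) _.
  exact: (f_equal2 (fun p q => p - q) (derive_along (basis_row R a) oU sY Ux dX)
    (derive_along (basis_row R a) oU sX Ux dY)).
have assemble (p1 p2 p3 p4 q1 q2 r : E) (S T Q : R) :
  - dot y ((p1 + p2) - (p3 + p4)) - dot (q1 - q2) r =
  (dot y p3 + dot y p4 + dot q2 r + (S + T) + Q)
  - (dot y p1 + dot y p2 + dot q1 r + (T + S) + Q).
  by rewrite dotBr !dotDr dotDl dotNl; ring.
have pXY := prolongation_vertical_lift y m y2 dpX dX dY (dpY a).
have pYX := prolongation_vertical_lift y m y2 dpY dY dX (dpX a).
apply: esym; rewrite mxE; apply: etrans (f_equal2 (fun s t => s - t) pXY pYX) _.
apply: esym; apply: etrans (fibre_vertical_lift _ _ _) _.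
apply: etrans (f_equal2 (fun p q => - dot y p - dot q (row a m)) dL
  (lie_bracket_locE dX dY)) _.
have -> : \sum_c \sum_d y2 a c d * Y x 0 c * X x 0 d =
    \sum_c \sum_d y2 a c d * X x 0 c * Y x 0 d.
  rewrite exchange_big; apply: eq_bigr => c _; apply: eq_bigr => d _.
  by rewrite (sym a d c) mulrAC.
exact: assemble.
Qed.

End ProlongationBracket.

Lemma smooth_on_subset (R : realType) (V W : normedModType R) (U U' : set V)
  (f : V -> W) : U' `<=` U -> smooth_on U f -> smooth_on U' f.
Proof. by move=> sUU' sf vs x /sUU'; exact: sf. Qed.

(** * Fields on the manifold: the local results on overlaps of charts *)

Section ManifoldFields.
Variables (R : realType) (n : nat) (M : smooth_manifold R n).
Local Notation E := 'rV[R]_n.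
Implicit Types (i j : chart_index M) (x : E) (X Y : vf_family M).

Lemma overlapP i j x :
  overlap i j x <-> chart_img i x /\ chart_dom j (param i x).
Proof.
split=> [[p [ip jp] <-]|[[p ip <-]]]; first by rewrite chartK//; split=> //; exists p.
by rewrite chartK// => jp; exists p.
Qed.

Lemma overlap_chart_img i j : overlap i j `<=` chart_img i.
Proof. by move=> x /overlapP[]. Qed.

Lemma overlap_open i j : open (overlap i j).
Proof.
rewrite openE => x /overlapP[ix jx].
have near_img : \forall y \near x, chart_img i y.
  by apply: open_nbhs_nbhs; split=> //; exact: chart_img_open.
have near_dom : \forall y \near x, chart_dom j (param i y).
  apply: (param_continuous ix).
  by apply: open_nbhs_nbhs; split=> //; exact: chart_dom_open.
by apply: filterS2 near_img near_dom => y iy jy; apply/overlapP.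
Qed.

Lemma overlap_transition i j x : overlap i j x -> overlap j i (transition i j x).
Proof. by move=> [p [ip jp] <-]; rewrite /transition /= chartK//; exists p. Qed.

Lemma transitionK i j x : overlap i j x -> transition j i (transition i j x) = x.
Proof. by move=> [p [ip jp] <-]; rewrite /transition /= !chartK. Qed.

Lemma transition_img i j x : overlap i j x -> chart_img j (transition i j x).
Proof. by move=> /overlap_transition/overlap_chart_img. Qed.

Lemma smooth_on_overlap i j X : is_vector_field X -> smooth_on (overlap i j) (X i).
Proof. by move=> [sX _]; apply: smooth_on_subset (sX i); exact: overlap_chart_img. Qed.

Lemma cotangent_lift_field X :
  is_vector_field X -> is_cot_vector_field (cotangent_lift X).
Proof.
move=> vX; have [sX cX] := vX; split=> [i|i j u iju].
  split; first exact: sX.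
  by apply: smooth_on_cotangent_lift => //; exact: chart_img_open.
apply: (@cotangent_lift_related _ _ (overlap i j) (overlap j i)) => //.
- exact: overlap_open.
- exact: transition_smooth.
- exact: transition_smooth.
- exact: overlap_transition.
- exact: transitionK.
- exact: smooth_on_overlap.
- exact: smooth_on_overlap.
- exact: cX.
- exact: cX.
Qed.

Lemma vertical_lift_field X : is_vector_field X ->
  is_generalized_vector_field (vertical_rep (cotangent_lift X)).
Proof.
move=> vX; have [sX cX] := vX; split=> [i|i j z ijz].
  split; last by apply: smooth_on_vertical_lift => //; exact: chart_img_open.
  have oi : open (chart_img i) by exact: chart_img_open.
  change (smooth_on (chart_img i) (fun=> 0 : E)).
  apply/(smooth_on_mxP oi) => a b.
  rewrite (_ : (fun x => _) = fun=> 0); last by apply/funext => x; rewrite mxE.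
  exact: smooth_on_cst.
apply: (@vertical_rep_related _ _ (overlap i j) (overlap j i)) => //.
- exact: overlap_open.
- exact: transition_smooth.
- exact: transition_smooth.
- exact: overlap_transition.
- exact: transitionK.
- exact: smooth_on_overlap.
- exact: smooth_on_overlap.
- exact: cX.
Qed.

Lemma lincomb_field k X Y : is_vector_field X -> is_vector_field Y ->
  is_vector_field (vf_lincomb k X Y).
Proof.
move=> [sX cX] [sY cY]; split=> [i|i j x ijx].
  by apply: smooth_on_lincomb => //; exact: chart_img_open.
have dt : differentiable (transition i j) x.
  by apply: smooth_on_differentiable ijx; exact: transition_smooth.
apply: etrans (esym (deriveDdir _ _ dt)).
exact: (f_equal2 (fun v w => v + w)
  (etrans (f_equal ( *:%R k) (cX _ _ _ ijx)) (esym (deriveZdir _ _ dt))) (cY _ _ _ ijx)).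
Qed.

Lemma lie_bracket_field X Y : is_vector_field X -> is_vector_field Y ->
  is_vector_field (lie_bracket X Y).
Proof.
move=> vX vY; have [[sX cX] [sY cY]] := (vX, vY); split=> [i|i j x ijx].
  by apply: smooth_on_lie_bracket => //; exact: chart_img_open.
apply: (@lie_bracket_related _ _ (overlap i j) (chart_img j)) => //.
- exact: overlap_open.
- exact: transition_smooth.
- exact: transition_img.
- exact: smooth_on_overlap.
- exact: smooth_on_overlap.
- by move=> q; exact: cX.
- by move=> q; exact: cY.
Qed.

Lemma chart_differentiable X i x :
  is_vector_field X -> chart_img i x -> differentiable (X i) x.
Proof. by move=> [sX _]; exact: smooth_on_differentiable (sX i). Qed.

End ManifoldFields.

(** * The complete lift as generator of the cotangent flow *)

Section Slices.
Variables (R : realType) (V W Z : normedModType R).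

(** The two difference quotients are the same function of [h], so the equality holds at every point;
    it can thus be used for all times at once, including those at which the flow has left the
    chart. *)
Lemma derive_slicer (F : V * W -> Z) s p w :
  'D_w (fun q => F (s, q)) p = 'D_((0, w) : V * W) F (s, p).
Proof.
rewrite /derive; apply: (f_equal (fun k => lim (k @ 0^'))); apply/funext => h /=.
have -> : h *: ((0, w) : V * W) + (s, p) = (s, h *: w + p) :> V * W.
  by apply: (f_equal2 pair) => //=; rewrite scaler0 add0r.
by [].
Qed.

Lemma derive_slicel (F : V * W -> Z) s p v :
  'D_v (fun q => F (q, p)) s = 'D_((v, 0) : V * W) F (s, p).
Proof.
rewrite /derive; apply: (f_equal (fun k => lim (k @ 0^'))); apply/funext => h /=.
have -> : h *: ((v, 0) : V * W) + (s, p) = (h *: v + s, p) :> V * W.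
  by apply: (f_equal2 pair) => //=; rewrite scaler0 add0r.
by [].
Qed.

End Slices.

Section CotangentFlow.
Variables (R : realType) (n : nat) (M : smooth_manifold R n).
Local Notation E := 'rV[R]_n.
Variables (X : vf_family M) (D : set (R * M)) (phi : R -> M -> M).
Hypothesis flow : is_local_flow X D phi.
Variables (i : chart_index M) (x : E).
Hypothesis ix : chart_img i x.

Let Phi (u : R * E) : E := chart i (phi u.1 (param i u.2)).
Let e (a : 'I_n) : R * E := (0, basis_row R a).
Let S := [set u : R * E | [/\ chart_img i u.2, D (u.1, param i u.2) &
  chart_dom i (phi u.1 (param i u.2))]].

Let param_dom q : chart_img i q -> chart_dom i (param i q).
Proof. by move=> [p ip <-]; rewrite chartK. Qed.

Let paramK q : chart_img i q -> chart i (param i q) = q.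
Proof. by move=> [p ip <-]; rewrite chartK. Qed.

Let near_img q : chart_img i q -> \forall y \near q, chart_img i y.
Proof. by move=> iq; apply: open_nbhs_nbhs; split=> //; exact: chart_img_open. Qed.

Let smooth_Phi : smooth_on S Phi.
Proof. exact: flow_smooth flow i i. Qed.

Let Phi0 q : chart_img i q -> Phi (0, q) = q.
Proof. by move=> iq; rewrite /Phi (flow_0 flow) paramK. Qed.

Let velocity q : chart_img i q -> is_derive (0 : R) 1 (fun s => Phi (s, q)) (X i q).
Proof.
move=> iq; have := @flow_velocity _ _ _ _ _ _ flow i 0 (param i q).
rewrite (flow_0 flow) paramK//; apply; first exact: (flow_dom0 flow).
exact: param_dom.
Qed.

(** At time 0 the flow is the identity, so the point stays in the chart; the three open conditions
    then persist nearby by continuity of [param i] and of the flow. *)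
Let near_S : \forall u \near ((0, x) : R * E), S u.
Proof.
have c1 : {for ((0, x) : R * E), continuous (fun u : R * E => (u.1, param i u.2) : R * M)}.
  have cp : {for ((0, x) : R * E), continuous (fun u : R * E => param i u.2)}.
    apply: (@continuous_comp _ _ _ (@snd R E) (param i) (0, x)).
      exact: continuous_snd.
    exact: (param_continuous ix).
  exact: (cvg_pair (@continuous_fst _ R E (0, x)) cp).
have D0 : D (0, param i x) := flow_dom0 flow _.
have n1 : \forall u \near ((0, x) : R * E), chart_img i u.2.
  by apply: (@continuous_snd _ R E (0, x)); exact: near_img.
have n2 : \forall u \near ((0, x) : R * E), D (u.1, param i u.2).
  by apply: c1; apply: open_nbhs_nbhs; split=> //; exact: flow_open flow.
have n3 : \forall u \near ((0, x) : R * E), chart_dom i (phi u.1 (param i u.2)).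
  apply: (continuous_comp c1 (flow_continuous flow D0)).
  apply: open_nbhs_nbhs; split; first exact: chart_dom_open.
  by rewrite /= (flow_0 flow); exact: param_dom.
by apply: filterS3 n1 n2 n3 => u ? ? ?; split.
Qed.

Let S0 : S (0, x). Proof. exact: nbhs_singleton near_S. Qed.

Let differentiable_derive_Phi v : differentiable ('D_v Phi) ((0, x) : R * E).
Proof. exact: smooth_on_differentiable (smooth_on_derive v smooth_Phi) S0. Qed.

Lemma derive_Phi_base a v : 'D_((0, v) : R * E) ('D_(e a) Phi) (0, x) = 0.
Proof.
rewrite -derive_slicer.
transitivity ('D_v (fun=> basis_row R a : E) x); last exact: derive_cst.
apply: near_eq_derive; apply: filterS (near_img ix) => q iq.
rewrite /e -derive_slicer.
transitivity ('D_(basis_row R a) id q); last exact: derive_id.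
by apply: near_eq_derive; apply: filterS (near_img iq) => r; exact: Phi0.
Qed.

Lemma derive_Phi_time a : 'D_((1, 0) : R * E) ('D_(e a) Phi) (0, x) = partial (X i) a x.
Proof.
transitivity ('D_(e a) ('D_((1, 0) : R * E) Phi) (0, x)).
  apply: derive_comm => //; apply: filterS near_S => u.
  exact: smooth_on_differentiable smooth_Phi.
rewrite /e -derive_slicer; apply: near_eq_derive.
apply: filterS (near_img ix) => q iq; rewrite -derive_slicel.
by have [_] := velocity iq.
Qed.

Lemma derive_inverse_flow a :
  let h t := partial (fun q => Phi (- t, q)) a (Phi (t, x)) in
  differentiable h (0 : R) /\ 'D_1 h (0 : R) = - partial (X i) a x.
Proof.
(* Time enters [h] twice, through the map and through the point. As a composite with the curve [k],
   of velocity [(-1, X i x)] at 0, its derivative splits into a time part, which is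
   [- partial (X i) a x], and a base part, which vanishes. *)
move=> h; pose k (t : R) : R * E := (- t, Phi (t, x)).
have hE : h = 'D_(e a) Phi \o k by apply/funext => t; exact: derive_slicer.
have [dPhi vPhi] := velocity ix; have {}dPhi := (derivable1_diffP _ _).1 dPhi.
have dN : differentiable (fun t : R => - t) 0 by exact: differentiableN.
have dk : differentiable k 0 by exact: differentiable_pair.
have k0 : k 0 = (0, x) by rewrite /k oppr0 Phi0.
have dG : differentiable ('D_(e a) Phi) (k 0) by rewrite k0.
split; first by rewrite hE; exact: differentiable_comp.
have vk : 'D_1 k 0 = - ((1, 0) : R * E) + (0, X i x).
  apply: etrans (derive_pair _ dN dPhi) _; rewrite vPhi.
  have -> : 'D_1 (fun t : R => - t) 0 = -1 by exact: derive_val.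
  by apply: (f_equal2 pair) => /=; rewrite ?addr0// oppr0 add0r.
rewrite hE; apply: etrans (derive_compose _ dk dG) _.
rewrite vk k0; apply: etrans (deriveDdir _ _ (differentiable_derive_Phi _)) _.
rewrite derive_Phi_base addr0; apply: etrans (deriveNdir _ (differentiable_derive_Phi _)) _.
by rewrite derive_Phi_time.
Qed.

Lemma cotangent_lift_flow (y : E) :
  is_derive (0 : R) 1
    (fun t : R => cot_map (fun q => Phi (t, q)) (fun q => Phi (- t, q)) (x, y))
    ((X i x, fibre (cotangent_lift_loc (X i)) (x, y)) : E * E).
Proof.
pose h a t := partial (fun q => Phi (- t, q)) a (Phi (t, x)).
pose C (t : R) : E := \row_a dot y (h a t).
have dh a : differentiable (h a) 0 by have [] := derive_inverse_flow a.
have vh a : 'D_1 (h a) 0 = - partial (X i) a x by have [] := derive_inverse_flow a.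
have [dPhi vPhi] := velocity ix; have {}dPhi := (derivable1_diffP _ _).1 dPhi.
have CE a : (fun t => C t 0 a) = fun t => dot ((cst y : R -> E) t) (h a t).
  by apply/funext => t; rewrite mxE.
have dC : differentiable C 0.
  apply/differentiable_mxP => j a; rewrite (ord1 j) CE.
  by apply: differentiable_dot => //; exact: differentiable_cst.
have vC : 'D_1 C 0 = fibre (cotangent_lift_loc (X i)) (x, y).
  apply/rowP => a; apply: etrans (derive_coord _ 0 a dC) _.
  apply: etrans (f_equal (fun F : R -> R => 'D_1 F (0 : R)) (CE a)) _.
  apply: etrans (derive_dot _ (differentiable_cst y 0) (dh a)) _.
  by rewrite vh derive_cst dot0l add0r dotNr fibre_cotangent_lift.
apply: (@DeriveDef _ _ _ _ _ (fun t : R => (Phi (t, x), C t))).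
  by apply: diff_derivable; exact: differentiable_pair.
by apply: etrans (derive_pair _ dPhi dC) _; rewrite vPhi vC.
Qed.

End CotangentFlow.

Lemma cotangent_lift_generates (R : realType) (n : nat) (M : smooth_manifold R n)
  (X : vf_family M) :
  generates_cotangent_flow X (cotangent_lift X).
Proof.
by move=> D phi flow i [x y] ix phi_loc; exact: (cotangent_lift_flow flow ix y).
Qed.

Theorem proposition2 (R : realType) (n : nat) (M : smooth_manifold R n) :
  (* X^{c*} is a vector field on T^*M, generating the flow T^*phi_{-t} *)
  (forall X : vf_family M, is_vector_field X ->
     is_cot_vector_field (cotangent_lift X) /\
     generates_cotangent_flow X (cotangent_lift X)) /\
  (* V X^{c*} is a generalized vector field of order one *)
  (forall X : vf_family M, is_vector_field X ->
     is_generalized_vector_field (vertical_rep (cotangent_lift X))) /\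
  (* linearity *)
  (forall (k : R) (X Y : vf_family M), is_vector_field X -> is_vector_field Y ->
     is_vector_field (vf_lincomb k X Y) /\
     gvf_eq (vertical_rep (cotangent_lift (vf_lincomb k X Y)))
       (gvf_lincomb k (vertical_rep (cotangent_lift X))
                      (vertical_rep (cotangent_lift Y)))) /\
  (* injectivity *)
  (forall X Y : vf_family M, is_vector_field X -> is_vector_field Y ->
     gvf_eq (vertical_rep (cotangent_lift X)) (vertical_rep (cotangent_lift Y)) ->
     vf_eq X Y) /\
  (* V [X, Y]^{c*} = [V X^{c*}, V Y^{c*}]_pro *)
  (forall X Y : vf_family M, is_vector_field X -> is_vector_field Y ->
     is_vector_field (lie_bracket X Y) /\
     gvf2_eq (to_order2 (vertical_rep (cotangent_lift (lie_bracket X Y))))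
       (pro_bracket (vertical_rep (cotangent_lift X))
                    (vertical_rep (cotangent_lift Y)))).
Proof.
split; [|split; [|split; [|split]]].
- move=> X vX; split; first exact: cotangent_lift_field.
  exact: cotangent_lift_generates.
- by move=> X; exact: vertical_lift_field.
- move=> k X Y vX vY; split; first exact: lincomb_field.
  move=> i z iz; split; first by apply/rowP => a; rewrite !mxE mulr0 addr0.
  by apply: vertical_lift_lincomb; exact: chart_differentiable.
- move=> X Y vX vY XY i x ix; apply: vertical_lift_inj => m.
  exact: (XY i ((x, 0, m) : 'rV[R]_n * 'rV[R]_n * 'M[R]_n) ix).2.
- move=> X Y vX vY; split; first exact: lie_bracket_field.
  have [[sX _] [sY _]] := (vX, vY).
  move=> i [[[x y] m] y2] /= ix sym; split.
    apply/rowP => a; rewrite !mxE; apply: esym; apply: big1 => b _.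
    by rewrite !mxE !mul0r subrr.
  apply: pro_bracket_vertical_lift ix sym => //; exact: chart_img_open.
Qed.
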